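(* Let $\mu,\nu\in\mathcal P_2(\mathbb R)$ be such that $\mu\le_{cx}\nu$. Then the set $\{\mathrm{sq}\#\pi:\pi\in\Pi_M(\mu,\nu)\}$ admits an infimum and a supremum for the convex order.
   Context: $\mathcal P_\rho(\mathbb R)$ is the set of probability measures on $\mathbb R$ with finite moment of order $\rho$. The convex order $\eta\le_{cx}\theta$ for $\eta,\theta\in\mathcal P_1(\mathbb R)$ means $\int\varphi\,d\eta\le\int\varphi\,d\theta$ for every convex $\varphi:\mathbb R\to\mathbb R$; infimum and supremum are greatest lower bound and least upper bound in $\mathcal P_1(\mathbb R)$ partially ordered by $\le_{cx}$. $\Pi(\mu,\nu)$ is the set of probability measures on $\mathbb R\times\mathbb R$ with first marginal $\mu$ and second marginal $\nu$; $\Pi_M(\mu,\nu)$ is the set of martingale couplings, i.e. of $\pi(dx,dy)=\mu(dx)\pi_x(dy)\in\Pi(\mu,\nu)$ such that $\int_{\mathbb R} y\,\pi_x(dy)=x$ for $\mu(dx)$-almost every $x$. $\mathrm{sq}(x,y)=(y-x)^2$ and $\mathrm{sq}\#\pi$ is the image (push-forward) of $\pi$ by $\mathrm{sq}$. *)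

(* Defs.v *)
From HB Require Import structures.
From mathcomp Require Import all_boot all_order all_algebra.
From mathcomp Require Import all_classical all_reals all_analysis.
From mathcomp Require Import measurable_realfun.

Set Implicit Arguments.
Unset Strict Implicit.
Unset Printing Implicit Defensive.

Import Order.TTheory GRing.Theory Num.Theory.
Import numFieldNormedType.Exports.

Local Open Scope classical_set_scope.
Local Open Scope ring_scope.

Section definitions.
Context {R : realType}.
Implicit Types (mu nu eta theta : probability R R).
Implicit Type pi : probability (R * R)%type R.

Definition finite_moment (rho : R) : set (probability R R) :=
  [set mu : probability R R | (\int[mu]_x (`|x| `^ rho)%:E < +oo)%E].

(* A convex function is bounded below by an affine one, so against a measure
   with finite first moment its negative part is integrable, and the extended
   integral is its usual value in ]-oo, +oo]. *)
Definition cx_le eta theta : Prop :=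
  [/\ finite_moment 1 eta, finite_moment 1 theta &
      forall phi : R -> R, convex_function [set: R^o] phi ->
        (\int[eta]_x (phi x)%:E <= \int[theta]_x (phi x)%:E)%E].

(* A value of [probability R R] is a function on all subsets of R whose values
   outside the Borel sets are unconstrained: the order only sees the Borel
   sets, so it is antisymmetric, and bounds are unique, up to equality on
   these. *)
Definition cx_infimum (S : set (probability R R)) (m : probability R R) :
    Prop :=
  [/\ finite_moment 1 m,
      forall eta, S eta -> cx_le m eta &
      forall l, finite_moment 1 l ->
        (forall eta, S eta -> cx_le l eta) -> cx_le l m].

Definition cx_supremum (S : set (probability R R)) (m : probability R R) :
    Prop :=
  [/\ finite_moment 1 m,
      forall eta, S eta -> cx_le eta m &
      forall u, finite_moment 1 u ->
        (forall eta, S eta -> cx_le eta u) -> cx_le m u].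

Definition coupling mu nu : set (probability (R * R)%type R) :=
  [set pi : probability (R * R)%type R | forall A : set R, measurable A ->
     pushforward pi fst A = mu A /\ pushforward pi snd A = nu A].

Definition disintegration pi mu (k : R.-pker R ~> R) : Prop :=
  forall A : set (R * R), measurable A ->
    pi A = (\int[mu]_x k x (xsection A x))%E.

(* The extended integral of y is +oo or -oo when y is not integrable, so the
   equation with the finite value x includes integrability. *)
Definition martingale_coupling mu nu : set (probability (R * R)%type R) :=
  coupling mu nu `&`
  [set pi : probability (R * R)%type R | exists2 k : R.-pker R ~> R, disintegration pi mu k &
     {ae mu, forall x, (\int[k x]_y y%:E = x%:E)%E}].

Definition sq (xy : R * R) : R := (xy.2 - xy.1) ^+ 2.

Lemma measurable_sq : measurable_fun [set: R * R] sq.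
Proof. by apply: measurable_funX; exact: measurable_funB. Qed.

HB.instance Definition _ :=
  @isMeasurableFun.Build _ _ (R * R)%type R sq measurable_sq.

Definition sq_image pi : probability R R := distribution pi sq.

End definitions.

(* Main.v *)
Require Import Defs.
From HB Require Import structures.
From mathcomp Require Import all_boot all_order all_algebra.
From mathcomp Require Import all_classical all_reals all_analysis.
From mathcomp Require Import measurable_realfun.
From mathcomp Require Import lra ring.
Import Order.TTheory GRing.Theory Num.Theory.
Import numFieldNormedType.Exports.
Set Implicit Arguments.
Unset Strict Implicit.
Unset Printing Implicit Defensive.
Local Open Scope classical_set_scope.
Local Open Scope ring_scope.

(** A probability measure P on the line with a finite first moment is encoded
    by its call function, t |-> \int max(0, x - t) P(dx).  The call functions
    of the measures of mean m are the convex functions lying above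
    max(0, m - t) and asymptotic to it at both ends ([call_function],
    [call_function_call], [call_function_realized]), and two measures with the
    same call function agree on the Borel sets ([eq_probability_call]).  Between
    measures with the same mean, the convex order is the pointwise order of the
    call functions ([cx_le_call], [cx_le_of_call]).

    Under a martingale coupling of mu and nu, the squared increment
    (y - x)^2 has mean \int y^2 dnu - \int x^2 dmu, whatever the coupling
    ([integral_sq]).  The problem thus becomes one about functions: given a
    nonempty family of call functions of a common mean m, find the largest
    call function below all of them and the least one above all of them.  For
    the infimum, take the supremum of all convex minorants: it lies between
    max(0, m - t) and any member of the family, so it has the required
    asymptotes.  For the supremum, take the pointwise supremum: it is convex,
    but it tends to 0 at +oo only if the family has a common majorant that
    does, and this follows from (y - x)^2 <= 2 x^2 + 2 y^2 and the second
    moments of mu and nu ([call_sq_image]).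

    The family has to be nonempty, because the empty family has no infimum and
    no supremum; so a martingale coupling has to be found, which is Strassen's
    theorem ([strassen]).  Its proof here is a construction on call functions.
    Replacing a convex function by its chord over [a, b] is, for the measure,
    sweeping the mass of ]a, b[ to a and b without moving its barycentre.
    Chords contained in tangent lines of the call function q of nu at the
    rational points raise the call function of mu to q ([exists_bridging]).
    Taking chords is linear in the function, so the same chords applied to the
    call functions max(0, x - t) of the point masses give, for each x, an
    increasing sequence of call functions of mean x, whose averages under mu
    increase to q.  By monotone convergence the limits V x average to q, and
    for almost every x no mass is lost ([call_decomposition]).  The measures
    with call functions V x form the kernel of a martingale coupling.

    The same theorem shows that the pointwise order of the call functions
    implies the convex order: it provides a kernel k, with k x of mean x,
    whose mixture under P is Q, and Jensen's inequality applies to each k x. *)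

(** * Convex functions on the line *)

Section convex_functions.
Context {R : realType}.
Implicit Types (f g p q : R -> R) (a b c r s t x y : R).

(** The three-point inequality with the denominator cleared, which keeps
    divisions out of the computations. *)
Definition cvx f := forall a b t, a <= t -> t <= b ->
  (b - a) * f t <= (b - t) * f a + (t - a) * f b.

Lemma cvxP f : cvx f <-> convex_function [set: R^o] f.
Proof.
split=> [cf|cf a b t at_ tb].
  suff key (k x y : R) : 0 <= k -> k <= 1 ->
      f (k * x + (1 - k) * y) <= k * f x + (1 - k) * f y.
    by move=> l x y _ _; exact: (key l%:num x y (ge0 l) (le1 l)).
  move=> l0 l1; have [xy|xy|->] := ltgtP x y.
  - have h1 : 0 <= k * (y - x) by rewrite mulr_ge0//; lra.
    have h2 : 0 <= (1 - k) * (y - x) by apply: mulr_ge0; lra.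
    have := cf x y (k * x + (1 - k) * y); set w := f (_ + _).
    move=> H; have {}H := H ltac:(lra) ltac:(lra).
    have : 0 <= (y - x) * (k * f x + (1 - k) * f y - w) by lra.
    by rewrite pmulr_rge0 ?subr_gt0// subr_ge0.
  - have h1 : 0 <= k * (x - y) by rewrite mulr_ge0//; lra.
    have h2 : 0 <= (1 - k) * (x - y) by rewrite mulr_ge0//; lra.
    have := cf y x (k * x + (1 - k) * y); set w := f (_ + _).
    move=> H; have {}H := H ltac:(lra) ltac:(lra).
    have : 0 <= (x - y) * (k * f x + (1 - k) * f y - w) by lra.
    by rewrite pmulr_rge0 ?subr_gt0// subr_ge0.
  - by rewrite -!mulrDl addrCA subrr addr0 !mul1r.
have [ab|] := ltP a b; last first.
  move=> ba; have -> : t = a by lra.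
  have -> : b = a by lra.
  lra.
have k01 : 0 <= (b - t) / (b - a) <= 1.
  by apply/andP; split; [rewrite divr_ge0//|rewrite ler_pdivrMr]; lra.
have := cf (Itv01 (andP k01).1 (andP k01).2) a b (in_setT _) (in_setT _).
rewrite !convRE/=.
set k := (b - t) / (b - a).
change ((k *: a + (1 - k) *: b : R^o)) with (k * a + (1 - k) * b).
change (f (k * a + (1 - k) * b) <= k * f a + (1 - k) * f b -> 
  (b - a) * f t <= (b - t) * f a + (t - a) * f b).
have ba0 : b - a != 0 by rewrite subr_eq0 gt_eqF.
have -> : k * a + (1 - k) * b = t by rewrite /k; field.
rewrite -(ler_pM2l (_ : 0 < b - a)) ?subr_gt0// => /le_trans; apply.
by rewrite le_eqVlt; apply/orP; left; apply/eqP; rewrite /k; field.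
Qed.

Lemma cvx_affine c d : cvx (fun x => d + c * x).
Proof. by move=> a b t _ _; lra. Qed.

Lemma cvxD f g : cvx f -> cvx g -> cvx (f \+ g).
Proof. by move=> cf cg a b t at_ tb /=; have := cf _ _ _ at_ tb; have := cg _ _ _ at_ tb; lra. Qed.

Lemma cvx_max f g : cvx f -> cvx g -> cvx (fun x => Num.max (f x) (g x)).
Proof.
move=> cf cg a b t at_ tb; have := cf _ _ _ at_ tb; have := cg _ _ _ at_ tb.
set fa := f a; set fb := f b; set ga := g a; set gb := g b.
have : fa <= Num.max fa ga by rewrite le_max lexx.
have : ga <= Num.max fa ga by rewrite le_max lexx orbT.
have : fb <= Num.max fb gb by rewrite le_max lexx.
have : gb <= Num.max fb gb by rewrite le_max lexx orbT.
by case: (leP (f t) (g t)) => _; nra.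
Qed.

(** The majorant B is there to keep the real supremum finite. *)
Lemma cvx_sup (F : set (R -> R)) (B : R -> R) : F !=set0 ->
  (forall f, F f -> cvx f) -> (forall f t, F f -> f t <= B t) ->
  cvx (fun t => sup [set f t | f in F]).
Proof.
move=> [f0 Ff0] cF FB a b t at_ tb.
have [ab|ba] := eqVneq a b; first by rewrite ab (_ : t = b); lra.
have ub s f : F f -> f s <= sup [set f s | f in F].
  by move=> Ff; apply: ub_le_sup; [exists (B s) => _ [g Fg <-]; exact: FB|exists f].
have ab0 : 0 < b - a by rewrite subr_gt0 lt_neqAle ba; lra.
rewrite mulrC -ler_pdivlMr//; apply: ge_sup; first by exists (f0 t), f0.
move=> _ [f Ff <-]; rewrite ler_pdivlMr// mulrC.
have := cF _ Ff _ _ _ at_ tb; have := ub a _ Ff; have := ub b _ Ff; nra.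
Qed.

(** Every slope to the left of x is at most every slope to its right; the
    supremum of the left slopes separates them. *)
Lemma cvx_subgradient f x : cvx f -> exists c, forall y, f x + c * (y - x) <= f y.
Proof.
move=> cf.
pose S := [set (f x - f s) / (x - s) | s in [set s | s < x]].
have S0 : S !=set0 by exists ((f x - f (x - 1)) / (x - (x - 1))), (x - 1) => //=; lra.
have ubS u : x < u -> ubound S ((f u - f x) / (u - x)).
  move=> xu _ [s /= sx <-]; rewrite ler_pdivrMr ?subr_gt0// mulrAC ler_pdivlMr ?subr_gt0//.
  by have := cf s u x (ltW sx) (ltW xu); lra.
exists (sup S) => y; have [yx|xy|->] := ltgtP y x; last by rewrite subrr mulr0 addr0.
  have : (f x - f y) / (x - y) <= sup S.
    apply: ub_le_sup; last by exists y.
    by exists ((f (x + 1) - f x) / (x + 1 - x)); apply: ubS; lra.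
  by rewrite ler_pdivrMr ?subr_gt0//; lra.
have : sup S <= (f y - f x) / (y - x) by apply: ge_sup => //; exact: ubS.
by rewrite ler_pdivlMr ?subr_gt0//; lra.
Qed.

(** Within distance 1 of x, the chords from x - 1 and to x + 1 bound the
    slopes of f at x, which gives a local Lipschitz constant. *)
Lemma cvx_continuous f : cvx f -> continuous f.
Proof.
move=> cf x.
pose C := `|f (x + 1) - f x| + `|f x - f (x - 1)|.
have C0 : 0 <= C by rewrite addr_ge0.
have H y : `|y - x| <= 1 -> `|f x - f y| <= C * `|y - x|.
  rewrite /C => yx.
  have E1 := ler_norm (f (x + 1) - f x).
  have E2 := ler_norm (f x - f (x - 1)).
  have E3 := ler_norm (- (f (x + 1) - f x)).
  have E4 := ler_norm (- (f x - f (x - 1))).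
  rewrite normrN in E3; rewrite normrN in E4.
  set A := `|f (x + 1) - f x| in E1 E3 *; set B := `|f x - f (x - 1)| in E2 E4 *.
  move: yx; rewrite ler_norml => /andP[y1 y2].
  have [xy|yx] := leP x y.
    have H1 := cf x (x + 1) y ltac:(lra) ltac:(lra).
    have H2 := cf (x - 1) y x ltac:(lra) ltac:(lra).
    rewrite ler_norml ger0_norm; last by lra.
    by apply/andP; split; nra.
  have H1 := cf (x - 1) x y ltac:(lra) ltac:(lra).
  have H2 := cf y (x + 1) x ltac:(lra) ltac:(lra).
  rewrite ler_norml ltr0_norm; last by lra.
  by apply/andP; split; nra.
apply/cvgrPdist_le => e e0.
have d0 : 0 < e / (C + 1) by rewrite divr_gt0//; lra.
near=> y.
apply: le_trans (H _ _) _.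
  rewrite distrC; near: y; exact: (@cvgr_dist_le _ R^o _ _ _ id x cvg_id).
have : `|y - x| <= e / (C + 1).
  by rewrite distrC; near: y; exact: (@cvgr_dist_le _ R^o _ _ _ id x cvg_id).
rewrite ler_pdivlMr; last by lra.
have := normr_ge0 (y - x); nra.
Unshelve. all: by end_near. Qed.

Lemma cvx_measurable f : cvx f -> measurable_fun [set: R] f.
Proof. by move=> /cvx_continuous; exact: continuous_measurable_fun. Qed.

End convex_functions.

(** * Call functions *)

Section call_functions.
Context {R : realType}.
Implicit Types (f g h p q : R -> R) (a b c m r s t x y e : R).

(** As a function of t, the call function of the point mass at x. *)
Definition hinge t x := Num.max 0 (x - t).

Lemma hinge_ge0 t x : 0 <= hinge t x.
Proof. by rewrite /hinge le_max lexx. Qed.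

Lemma hinge_ge t x : x - t <= hinge t x.
Proof. by rewrite /hinge le_max lexx orbT. Qed.

Lemma hinge_le t x y : 0 <= y -> x - t <= y -> hinge t x <= y.
Proof. by rewrite /hinge ge_max => -> ->. Qed.

Lemma hinge_cvx_strike x : cvx (hinge ^~ x).
Proof.
apply: cvx_max => [a b t|a b t]; lra.
Qed.

Lemma hinge_cvx t : cvx (hinge t).
Proof.
apply: cvx_max => [a b s|a b s]; lra.
Qed.

(** The call functions of the measures of mean m.  The limits at +oo and -oo
    say that no mass sits at infinity. *)
Definition call_function m h :=
  [/\ cvx h,
      forall t, hinge t m <= h t,
      forall e, 0 < e -> exists T, forall t, T <= t -> h t <= e &
      forall e, 0 < e -> exists T, forall t, t <= T -> h t + t <= m + e].

Section theory.
Variables (m : R) (h : R -> R).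
Hypothesis mh : call_function m h.

Lemma call_cvx : cvx h. Proof. by case: mh. Qed.

Lemma call_ge0 t : 0 <= h t.
Proof. by case: mh => _ H _ _; apply: le_trans (hinge_ge0 _ _) (H t). Qed.

Lemma call_ge_mean t : m <= h t + t.
Proof.
by case: mh => _ H _ _; have := le_trans (hinge_ge _ _) (H t); lra.
Qed.

Lemma call_small e : 0 < e -> exists T, forall t, T <= t -> h t <= e.
Proof. by case: mh => _ _ H _; exact: H. Qed.

Lemma call_small_left e : 0 < e -> exists T, forall t, t <= T -> h t + t <= m + e.
Proof. by case: mh => _ _ _; exact. Qed.

(** If h increased between s and t, it would by convexity stay above h t > 0
    after t, and would not tend to 0. *)
Lemma call_nonincreasing s t : s <= t -> h t <= h s.
Proof.
move=> st; rewrite leNgt; apply/negP => hst.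
have ht0 : 0 < h t by apply: le_lt_trans (call_ge0 s) hst.
have [T hT] := call_small (e := h t / 2) ltac:(lra).
have tu : t <= Num.max T t by rewrite le_max lexx orbT.
have := hT (Num.max T t); rewrite le_max lexx => /(_ isT); move: tu.
set u := Num.max T t => tu hu.
have := call_cvx st tu; have {}st : s < t.
  by rewrite lt_neqAle st andbT; apply/eqP => E; move: hst; rewrite E ltxx.
have : 0 < (t - s) * (h t - h u) by apply: mulr_gt0; lra.
have : 0 <= (u - t) * (h t - h s) by apply: mulr_ge0; lra.
lra.
Qed.

(** The mirror image of [call_nonincreasing]: h + id is convex and tends at
    -oo to its lower bound m, so it is nondecreasing. *)
Lemma call_Lipschitz s t : s <= t -> h s <= h t + (t - s).
Proof.
move=> st; rewrite leNgt; apply/negP => hst.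
have hs0 : 0 < h s + s - m by have := call_ge_mean t; lra.
have [T hT] := call_small_left (e := (h s + s - m) / 2) ltac:(lra).
have us : Num.min T s <= s by rewrite ge_min lexx orbT.
have := hT (Num.min T s); rewrite ge_min lexx => /(_ isT); move: us.
set u := Num.min T s => us hu.
have := call_cvx us st; have {}st : s < t.
  by rewrite lt_neqAle st andbT; apply/eqP => E; move: hst; rewrite E; lra.
have : 0 < (t - s) * (h s + s - (h u + u)) by apply: mulr_gt0; lra.
have : 0 <= (s - u) * (h s + s - (h t + t)) by apply: mulr_ge0; lra.
lra.
Qed.

Lemma call_function_squeeze g : cvx g -> (forall t, hinge t m <= g t) ->
  (forall t, g t <= h t) -> call_function m g.
Proof.
move=> cg mg gh; split => // e e0.
  have [T hT] := call_small e0; exists T => t Tt.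
  exact: le_trans (gh t) (hT t Tt).
have [T hT] := call_small_left e0; exists T => t Tt.
by have := gh t; have := hT t Tt; lra.
Qed.

End theory.

Lemma call_function_hinge m : call_function m (hinge ^~ m).
Proof.
split => [|//|e e0|e e0]; first exact: hinge_cvx_strike.
  by exists m => t mt; apply: hinge_le; lra.
exists m => t mt; have : hinge t m <= m - t by apply: hinge_le; lra.
lra.
Qed.

(** The slopes of call functions lie between -1 and 0, so a bound at a single
    point bounds the family everywhere, and small values at single points on
    the right and on the left are small tails. *)
Lemma call_function_sup m (U : nat -> R -> R) :
  (forall n, call_function m (U n)) ->
  (forall e, 0 < e -> exists s, forall n, U n s <= e) ->
  (forall e, 0 < e -> exists s, forall n, U n s + s <= m + e) ->
  (forall t, has_ubound (range (U ^~ t))) /\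
  call_function m (fun t => sup (range (U ^~ t))).
Proof.
move=> cU g1 g2.
have bounded t : exists b, forall n, U n t <= b.
  have [s hs] := g1 _ ltr01; exists (1 + `|s - t|) => n.
  have := hs n; have := normr_ge0 (s - t); have := ler_norm (s - t).
  have [st|ts] := leP s t; first by have := call_nonincreasing (cU n) st; lra.
  by have := call_Lipschitz (cU n) (ltW ts); lra.
have ub t : has_ubound (range (U ^~ t)).
  by have [b hb] := bounded t; exists b => _ [n _ <-].
have sup_le t b : (forall n, U n t <= b) -> sup (range (U ^~ t)) <= b.
  by move=> hb; apply: ge_sup; [exists (U 0 t), 0%N|move=> _ [n _ <-]].
split => //; split.
- have [B hB] := choice bounded.
  have -> : (fun t => sup (range (U ^~ t))) =
      (fun t => sup [set g t | g in range U]).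
    apply/funext => t; congr sup; apply/seteqP.
    by split=> [_ [n _ <-]|_ [_ [n _ <-] <-]]; [exists (U n) => //; exists n|exists n].
  apply: (cvx_sup (B := B)); first by exists (U 0), 0%N.
    by move=> _ [n _ <-]; exact: call_cvx (cU n).
  by move=> _ t [n _ <-].
- move=> t; apply: (@le_trans _ _ (U 0 t)); first by have [_] := cU 0%N.
  by apply: ub_le_sup => //; exists 0%N.
- move=> e /g1[s hs]; exists s => t st; apply: sup_le => n.
  exact: le_trans (call_nonincreasing (cU n) st) (hs n).
- move=> e /g2[s hs]; exists s => t ts.
  rewrite -lerBrDr; apply: sup_le => n.
  by have := call_Lipschitz (cU n) ts; have := hs n; lra.
Qed.

End call_functions.

(** * Replacing arcs of a call function by chords *)

Section bridges.
Context {R : realType}.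
Implicit Types (f g h p q : R -> R) (a b c m r s t x y e : R).

(** The graph of f over ]a, b[ is replaced by its chord.  On call functions
    this sweeps the mass of ]a, b[ to the endpoints a and b. *)
Definition bridge a b f t :=
  if a < t < b then ((b - t) * f a + (t - a) * f b) / (b - a) else f t.

Lemma bridge_in a b f t : a < t -> t < b ->
  (b - a) * bridge a b f t = (b - t) * f a + (t - a) * f b.
Proof.
by move=> at_ tb; rewrite /bridge at_ tb/= mulrC divfK//; apply/eqP; lra.
Qed.

Lemma bridge_out a b f t : (t <= a) || (b <= t) -> bridge a b f t = f t.
Proof. by rewrite /bridge; case: ifP => // /andP[h1 h2]; rewrite !leNgt h1 h2. Qed.

Variant bridge_spec a b f t : R -> Type :=
| BridgeIn u of a < t & t < b & (b - a) * u = (b - t) * f a + (t - a) * f b :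
   bridge_spec a b f t u
| BridgeOut of (t <= a) || (b <= t) : bridge_spec a b f t (f t).

Lemma bridgeP a b f t : bridge_spec a b f t (bridge a b f t).
Proof.
have [H|H] := boolP ((t <= a) || (b <= t)); first by rewrite bridge_out//; constructor.
move: H; rewrite negb_or -!ltNge => /andP[H1 H2]; constructor => //.
exact: bridge_in.
Qed.

Lemma le_bridge a b f t : cvx f -> f t <= bridge a b f t.
Proof.
move=> cf; case: bridgeP => // u at_ tb H.
rewrite -(ler_pM2l (_ : 0 < b - a)); last by lra.
by rewrite H; apply: cf; exact: ltW.
Qed.

Lemma bridge_le_line a b f q c d : a < b -> f a = d + c * a -> f b = d + c * b ->
  (forall t, d + c * t <= q t) -> (forall t, f t <= q t) ->
  forall t, bridge a b f t <= q t.
Proof.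
move=> ab fa fb lq fq t; case: bridgeP => // u at_ tb; rewrite fa fb => H.
apply: le_trans (lq t); rewrite -(ler_pM2l (_ : 0 < b - a)); lra.
Qed.

Lemma bridge_line a b f c d t : a < t -> t < b -> f a = d + c * a -> f b = d + c * b ->
  bridge a b f t = d + c * t.
Proof.
move=> at_ tb fa fb; have := bridge_in f at_ tb.
have ba0 : b - a != 0 by apply/eqP; lra.
by rewrite fa fb => H; apply: (mulfI ba0); lra.
Qed.

(** For a convex f, the result is the maximum of f and of the line through
    the two endpoints of the chord. *)
Lemma bridge_cvx a b f : cvx f -> cvx (bridge a b f).
Proof.
move=> cf.
have [ab|ba] := ltP a b; last first.
  suff -> : bridge a b f = f by [].
  by apply/funext => t; rewrite bridge_out//; case: (leP t a) => //= ta; lra.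
pose c := (f b - f a) / (b - a); pose d := f a - c * a.
suff -> : bridge a b f = (fun t => Num.max (f t) (d + c * t)).
  by apply: cvx_max => //; exact: cvx_affine.
have ba0 : b - a != 0 by apply/eqP; lra.
have fa : f a = d + c * a by rewrite /d; lra.
have fb : f b = d + c * b by rewrite /d /c; field.
apply/funext => t; have [H|H] := boolP ((t <= a) || (b <= t)).
  rewrite bridge_out//; apply/esym/max_idPl.
  rewrite -(ler_pM2l (_ : 0 < b - a)); last by lra.
  case/orP : H => H.
    by have := cf t b a H (ltW ab); rewrite fa fb; lra.
  by have := cf a t b (ltW ab) H; rewrite fa fb; lra.
move: H; rewrite negb_or -!ltNge => /andP[H1 H2].
rewrite (bridge_line H1 H2 fa fb); apply/esym/max_idPr.
by rewrite -(bridge_line H1 H2 fa fb); exact: le_bridge.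
Qed.

Lemma call_function_bridge a b m f : call_function m f ->
  call_function m (bridge a b f).
Proof.
move=> [cf mf f1 f2]; split => [|t|e e0|e e0]; first exact: bridge_cvx.
- exact: le_trans (mf t) (le_bridge _ _ _ cf).
- have [T hT] := f1 _ e0; exists (Num.max T b) => t.
  by rewrite ge_max => /andP[Tt bt]; rewrite bridge_out ?bt ?orbT//; exact: hT.
- have [T hT] := f2 _ e0; exists (Num.min T a) => t.
  by rewrite le_min => /andP[Tt bt]; rewrite bridge_out ?bt//; exact: hT.
Qed.

End bridges.

Section bridging.
Context {R : realType}.
Implicit Types (f g h p q : R -> R) (a b c d k m r s t x y e : R).

(** An affine function that starts at d and is eventually at most d / 2
    decreases, hence ends up below 0. *)
Lemma affine_nonpos d k s0 : 0 < d ->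
  (forall s, s0 <= s -> d + k * s <= d / 2) -> exists2 s, 0 < s & d + k * s <= 0.
Proof.
move=> d0 H.
pose s1 := Num.max s0 1.
have s1s0 : s0 <= s1 by rewrite le_max lexx.
have s11 : 1 <= s1 by rewrite le_max lexx orbT.
have := H _ s1s0; move: s11; clearbody s1 => s11 h1.
exists (2 * s1); first by lra.
lra.
Qed.

(** The tangent line of q at r stays below q.  At r the function p is below
    this line, and far away on both sides it is above it: otherwise the line
    would be caught between the asymptote and q, which get arbitrarily close.
    Hence p meets the line at some a < r < b, and its chord over [a, b] is a
    segment of a line that lies below q and touches q at r. *)
Lemma touching_interval m p q r : call_function m p -> call_function m q ->
  (forall t, p t <= q t) ->
  exists ab : R * R, (forall t, bridge ab.1 ab.2 p t <= q t) /\
    bridge ab.1 ab.2 p r = q r.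
Proof.
move=> mp mq pq.
have [pqr|] := ltP (p r) (q r); last first.
  move=> qpr; have E : p r = q r by apply/eqP; rewrite eq_le pq.
  by exists (r, r) => /=; split=> [t|]; rewrite bridge_out ?lexx//; case: leP => //= /ltW.
have [c cq] := cvx_subgradient r (call_cvx mq).
pose l t := (q r - c * r) + c * t.
have lq t : l t <= q t by have := cq t; rewrite /l; lra.
have lr : l r = q r by rewrite /l; lra.
have pcont := cvx_continuous (call_cvx mp).
have lcont : continuous l := cvx_continuous (@cvx_affine _ _ _).
have cont : continuous (p \- l) by move=> x; apply: (@cvgB _ R^o); [exact: pcont|exact: lcont].
(* At -oo the excess over the asymptote m - t is compared: it is q r + r - m
   for the line at r, and at most half of this for q far to the left. *)
have [u ur pu] : exists2 u, u < r & l u <= p u.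
  have [T hT] := call_small_left mq (e := (q r + r - m) / 2)
    ltac:(have := call_ge_mean mp r; lra).
  have d0 : 0 < q r + r - m by have := call_ge_mean mp r; lra.
  have [s s0 hs] := @affine_nonpos (q r + r - m) (- (c + 1)) (r - T) d0
    ltac:(move=> s Ts; have := hT (r - s) ltac:(lra); have := lq (r - s); rewrite /l; lra).
  exists (r - s); first by lra.
  by have := call_ge_mean mp (r - s); rewrite /l; lra.
have [v rv pv] : exists2 v, r < v & l v <= p v.
  have d0 : 0 < q r by have := call_ge0 mp r; lra.
  have [T hT] := call_small mq (e := (q r) / 2) ltac:(lra).
  have [s s0 hs] := @affine_nonpos (q r) c (T - r) d0
    ltac:(move=> s Ts; have := hT (r + s) ltac:(lra); have := lq (r + s); rewrite /l; lra).
  exists (r + s); first by lra.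
  by have := call_ge0 mp (r + s); rewrite /l; lra.
have [a /[!in_itv]/= /andP[ua ar] pa] : exists2 a, a \in `[u, r] & (p \- l) a = 0.
  apply: IVT => /=; [exact: ltW|exact: continuous_subspaceT|].
  by rewrite ge_min le_max; apply/andP; split; apply/orP; [right|left]; lra.
have [b /[!in_itv]/= /andP[rb bv] pb] : exists2 b, b \in `[r, v] & (p \- l) b = 0.
  apply: IVT => /=; [exact: ltW|exact: continuous_subspaceT|].
  by rewrite ge_min le_max; apply/andP; split; apply/orP; [left|right]; lra.
have {}ar : a < r.
  by rewrite lt_neqAle ar andbT; apply/eqP => E; move: pa; rewrite E; lra.
have {}rb : r < b.
  by rewrite lt_neqAle rb andbT; apply/eqP => E; move: pb; rewrite -E; lra.
have {}pa : p a = l a by lra.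
have {}pb : p b = l b by lra.
exists (a, b) => /=; split; last by rewrite -lr; exact: bridge_line.
by apply: bridge_le_line pa pb lq pq; lra.
Qed.

Fixpoint bridging (I : nat -> R * R) f n :=
  if n is n'.+1 then bridge (I n').1 (I n').2 (bridging I f n') else f.

Lemma call_function_bridging I m f n : call_function m f ->
  call_function m (bridging I f n).
Proof. by move=> mf; elim: n => //= n IH; exact: call_function_bridge. Qed.

Lemma bridging_nd I m f t : call_function m f ->
  nondecreasing_seq (fun n => bridging I f n t).
Proof.
move=> mf; apply/nondecreasing_seqP => n.
by apply: le_bridge; exact: call_cvx (call_function_bridging I n mf).
Qed.

Let rational n : R := ratr (odflt 0 (@unpickle rat n)).

(** Touch q at the rational points, one after the other.  The contacts persist,
    as the functions increase and stay below q; between the rational points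
    monotonicity and the Lipschitz bound take over. *)
Lemma exists_bridging m p q : call_function m p -> call_function m q ->
  (forall t, p t <= q t) ->
  exists I, (forall n t, bridging I p n t <= q t) /\
    forall t e, 0 < e -> exists n, q t - e <= bridging I p n t.
Proof.
move=> mp mq pq.
pose sel n (f : R -> R) := xget (0, 0) [set ab : R * R |
  (forall t, bridge ab.1 ab.2 f t <= q t) /\ bridge ab.1 ab.2 f (rational n) = q (rational n)].
pose fs := fix fs n : R -> R := if n is n'.+1 then
   bridge (sel n' (fs n')).1 (sel n' (fs n')).2 (fs n') else p.
pose I n := sel n (fs n).
have IE n : bridging I p n = fs n by elim: n => //= n ->.
have leq n : call_function m (fs n) /\ (forall t, fs n t <= q t).
  elim: n => //= n [IH1 IH2].
  case: (xgetPex (0, 0) (touching_interval (rational n) IH1 mq IH2)) => H _.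
  by split => //; exact: call_function_bridge.
have eqn n : fs n.+1 (rational n) = q (rational n).
  have [IH1 IH2] := leq n.
  by case: (xgetPex (0, 0) (touching_interval (rational n) IH1 mq IH2)).
exists I; split => [n t|t e e0]; first by rewrite IE; exact: (leq n).2.
have [x] := @rat_in_itvoo R t (t + e) ltac:(lra).
rewrite in_itv/= => /andP[tx xt].
have rx : rational (pickle x) = ratr x by rewrite /rational pickleK.
exists (pickle x).+1; rewrite IE.
have := call_nonincreasing (leq (pickle x).+1).1 (ltW tx).
have := eqn (pickle x); rewrite rx => ->.
by have := call_Lipschitz mq (ltW tx); lra.
Qed.

End bridging.

(** * Right derivatives as distribution functions *)

Section right_derivative.
Context {R : realType}.
Implicit Types (h : R -> R) (m r s t u x y e : R).

(** The right derivative of a convex function. *)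
Definition rder h t := inf [set (h u - h t) / (u - t) | u in [set u | t < u]].

Section convex.
Variable h : R -> R.
Hypothesis ch : cvx h.

Let slopes t := [set (h u - h t) / (u - t) | u in [set u | t < u]].

Let slopes_nonempty t : slopes t !=set0.
Proof. by exists ((h (t + 1) - h t) / (t + 1 - t)), (t + 1) => //=; rewrite ltrDl. Qed.

Let slopes_lb s t : s < t -> lbound (slopes t) ((h t - h s) / (t - s)).
Proof.
move=> st _ [u /= tu <-]; rewrite ler_pdivrMr ?subr_gt0// mulrAC ler_pdivlMr ?subr_gt0//.
by have := ch (ltW st) (ltW tu); lra.
Qed.

Lemma rder_le s t : s < t -> (t - s) * rder h s <= h t - h s.
Proof.
move=> st; rewrite mulrC -ler_pdivlMr ?subr_gt0//.
apply: ge_inf; last by exists t.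
by exists ((h s - h (s - 1)) / (s - (s - 1))); apply: slopes_lb; lra.
Qed.

Lemma rder_ge s t : s < t -> h t - h s <= (t - s) * rder h t.
Proof.
move=> st; rewrite mulrC -ler_pdivrMr ?subr_gt0//.
by apply: lb_le_inf; [exact: slopes_nonempty|exact: slopes_lb].
Qed.

Lemma rder_nondecreasing : nondecreasing (rder h).
Proof.
move=> s t; rewrite le_eqVlt => /predU1P[->//|st].
rewrite -(ler_pM2l (_ : 0 < t - s)) ?subr_gt0//.
exact: le_trans (rder_le st) (rder_ge st).
Qed.

(** Some slope from t to a point u is close to the infimum, and the slope from
    s to u depends continuously on s. *)
Lemma rder_right_continuous : right_continuous (rder h).
Proof.
move=> t; apply/cvgrPdist_le => e e0.
have [_ [u /= tu <-] hu] := inf_adherent (eps := e / 2) ltac:(lra)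
  (conj (slopes_nonempty t) (ex_intro _ _ (@slopes_lb (t - 1) t ltac:(lra)))).
rewrite -/(rder h t) in hu.
have hc := cvx_continuous ch.
have : (fun s => (h u - h s) / (u - s)) @ t --> (h u - h t) / (u - t).
  apply: cvgM; first by apply: cvgB; [exact: cvg_cst|exact: hc].
  apply: cvgV; first by rewrite gt_eqF// subr_gt0.
  by apply: cvgB; [exact: cvg_cst|exact: cvg_id].
move=> /(@cvg_at_right_filter _ _ _ _ _)/cvgrPdist_le /(_ (e / 2) ltac:(lra)) H.
near=> s.
have ts : t < s by near: s; exact: nbhs_right_gt.
have su : s < u by near: s; exact: nbhs_right_lt.
have : `|(h u - h t) / (u - t) - (h u - h s) / (u - s)| <= e / 2 by near: s.
rewrite ler_norml => /andP[H1 H2].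
have H3 := rder_nondecreasing (ltW ts).
have : rder h s <= (h u - h s) / (u - s).
  by rewrite ler_pdivlMr ?subr_gt0// mulrC; exact: rder_le.
rewrite ler_norml => H4; apply/andP; split; lra.
Unshelve. all: by end_near. Qed.

End convex.

Section call.
Variables (m : R) (h : R -> R).
Hypothesis mh : call_function m h.
Let ch := call_cvx mh.

Lemma rder_le0 t : rder h t <= 0.
Proof.
have := rder_le ch (_ : t < t + 1); have := call_nonincreasing mh (_ : t <= t + 1).
by move=> /(_ ltac:(lra)) H1 /(_ ltac:(lra)); lra.
Qed.

Lemma rder_geN1 t : -1 <= rder h t.
Proof.
have := rder_ge ch (_ : t - 1 < t); have := call_Lipschitz mh (_ : t - 1 <= t).
by move=> /(_ ltac:(lra)) H1 /(_ ltac:(lra)); lra.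
Qed.

Lemma rder_cvg0 : 1 + rder h t @[t --> +oo] --> (1 : R).
Proof.
apply/cvgrPdist_le => e e0.
have [T hT] := call_small mh e0.
near=> t.
have Tt : T <= t - 1 by rewrite lerBrDr; near: t; apply: nbhs_pinfty_ge; exact: num_real.
have := hT _ Tt; have := rder_le0 t; have := rder_ge ch (_ : t - 1 < t).
move=> /(_ ltac:(lra)); have := call_ge0 mh t => H1 H2 H3 H4.
rewrite ger0_norm; lra.
Unshelve. all: by end_near. Qed.

Lemma rder_cvgN1 : 1 + rder h t @[t --> -oo] --> (0 : R).
Proof.
apply/cvgrPdist_le => e e0.
have [T hT] := call_small_left mh e0.
near=> t.
have Tt : t + 1 <= T by rewrite -lerBrDr; near: t; apply: nbhs_ninfty_le; exact: num_real.
have := hT _ Tt; have := rder_geN1 t; have := rder_le ch (_ : t < t + 1).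
move=> /(_ ltac:(lra)); have := call_ge_mean mh t => H1 H2 H3 H4.
rewrite sub0r normrN ger0_norm; lra.
Unshelve. all: by end_near. Qed.

(** The derivative in t of \int max(0, x - t) P(dx) is -P(]t, +oo[), so a
    measure with call function h must have 1 + h' as distribution function. *)
Lemma exists_probability_cdf :
  exists P : probability R R, forall t, P `]-oo, t]%classic = (1 + rder h t)%:E.
Proof.
pose F t : R := 1 + rder h t.
have F1 : nondecreasing F by move=> s t st; rewrite lerD2l; exact: rder_nondecreasing.
have F2 : right_continuous F.
  by move=> t; apply: cvgD; [exact: cvg_cst|exact: rder_right_continuous].
pose C := HB.pack_for (cumulativeBounded (0 : R) 1) F
  (isCumulative.Build R _ R F F1 F2)
  (isCumulativeBounded.Build R 0 1 F rder_cvgN1 rder_cvg0).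
pose idR : measurableTypeR R -> R := idfun.
pose X := HB.pack_for {mfun measurableTypeR R >-> R} idR
  (@isMeasurableFun.Build _ _ _ _ idR (@measurable_id _ _ setT)).
exists (distribution (lebesgue_stieltjes_measure C) X) => t.
exact: cdf_lebesgue_stieltjes_id.
Qed.

End call.
End right_derivative.

(** * The call function of a probability measure *)

Section call_of_measure.
Context {R : realType}.
Implicit Types (P Q : probability R R) (h : R -> R) (m r s t u x y e : R).

Definition call P t : R := \int[P]_x hinge t x.

Definition mean P : R := \int[P]_x x.

Definition rcdf P t : R := fine (P `]-oo, t]%classic).

Lemma rcdfE P t : (rcdf P t)%:E = P `]-oo, t]%classic.
Proof. by rewrite /rcdf fineK// fin_num_measure. Qed.

Lemma Rintegral_probability_cst d (T : measurableType d) (P : probability T R) c :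
  \int[P]_x c = c.
Proof. by rewrite Rintegral_cst//= probability_setT mulr1. Qed.

Lemma probability_tail P t : P `]t, +oo[%classic = (1 - rcdf P t)%:E.
Proof. by rewrite -setCitvl probability_setC// EFinB rcdfE. Qed.

Lemma measurable_hinge t : measurable_fun [set: R] (hinge t).
Proof. by apply: cvx_measurable; exact: hinge_cvx. Qed.

Lemma finite_moment1P P :
  finite_moment 1 P <-> P.-integrable [set: R] (EFin \o idfun).
Proof.
rewrite /finite_moment/=; under eq_integral do rewrite powRr1//.
split => [H|/integrableP[]//].
by apply/integrableP; split => //; apply/measurable_EFinP; exact: measurable_id.
Qed.

Lemma integrable_affine P c d : finite_moment 1 P ->
  P.-integrable [set: R] (EFin \o (fun x => d + c * x)).
Proof.
move=> /finite_moment1P iP.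
have -> : EFin \o (fun x => d + c * x) =
    (cst d%:E \+ (fun x => c%:E * (EFin \o idfun) x))%E by [].
apply: integrableD => //; first exact: finite_measure_integrable_cst.
exact: integrableZl.
Qed.

Lemma integrable_hinge P t : finite_moment 1 P ->
  P.-integrable [set: R] (EFin \o hinge t).
Proof.
move=> iP; have := integrable_affine 1 (- t) iP.
apply: le_integrable => //; first by apply/measurable_EFinP; exact: measurable_hinge.
move=> x _ /=; rewrite lee_fin ger0_norm ?hinge_ge0//.
by apply: hinge_le => //; have := ler_norm (- t + 1 * x); lra.
Qed.

Lemma mean_affine P c d : finite_moment 1 P ->
  \int[P]_x (d + c * x) = d + c * mean P.
Proof.
move=> iP; rewrite RintegralD//.
- rewrite Rintegral_probability_cst RintegralZl//.
  exact/finite_moment1P.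
- exact: finite_measure_integrable_cst.
- by have := integrable_affine c 0 iP; apply: eq_integrable => // x _ /=; rewrite add0r.
Qed.

Lemma callE P t : finite_moment 1 P -> (call P t)%:E = (\int[P]_x (hinge t x)%:E)%E.
Proof.
move=> iP; rewrite /call fineK//; apply: integrable_fin_num => //.
exact: integrable_hinge.
Qed.

Lemma meanE P : finite_moment 1 P -> (mean P)%:E = (\int[P]_x x%:E)%E.
Proof. by move=> /finite_moment1P iP; rewrite /mean fineK//; exact: integrable_fin_num. Qed.

Lemma call_measure_ge0 P t : 0 <= call P t.
Proof. by apply: Rintegral_ge0 => x _; exact: hinge_ge0. Qed.

Lemma call_measure_ge_mean P t : finite_moment 1 P -> mean P - t <= call P t.
Proof.
move=> iP; have -> : mean P - t = \int[P]_x (- t + 1 * x).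
  by rewrite mean_affine//; lra.
apply: le_Rintegral => //; [exact: integrable_affine|exact: integrable_hinge|].
by move=> x _; have := hinge_ge t x; lra.
Qed.

Lemma cvx_call P : finite_moment 1 P -> cvx (call P).
Proof.
move=> iP a b t at_ tb.
have ih s c : P.-integrable [set: R] (EFin \o (fun x => c * hinge s x)).
  have -> : EFin \o (fun x => c * hinge s x) = (fun x => c%:E * (EFin \o hinge s) x)%E by [].
  apply: integrableZl => //; exact: integrable_hinge.
have ih1 s : P.-integrable [set: R] (EFin \o hinge s) by exact: integrable_hinge.
rewrite /call -!RintegralZl// -RintegralD//.
apply: le_Rintegral => //.
  have -> : EFin \o (fun x => (b - t) * hinge a x + (t - a) * hinge b x) =
   ((EFin \o (fun x => (b - t) * hinge a x)%R) \+
    (EFin \o (fun x => (t - a) * hinge b x)%R))%E by [].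
  exact: integrableD.
by move=> x _; exact: hinge_cvx_strike.
Qed.

(** Dominated convergence along the integers, extended to all t by
    monotonicity; at -oo the integrand is the put max(0, t - x). *)
Lemma call_limits P : finite_moment 1 P ->
  (forall e, 0 < e -> exists T, forall t, T <= t -> call P t <= e) /\
  (forall e, 0 < e -> exists T, forall t, t <= T -> call P t + t <= mean P + e).
Proof.
move=> iP; have /finite_moment1P ix := iP.
split => e e0.
  have [|||||_ _] := @dominated_convergence _ R R P _ measurableT
    (fun n x => (hinge n%:R x)%:E) (cst 0%E) (fun x => `|x%:E|%E).
  - by move=> n; apply/measurable_EFinP; exact: measurable_hinge.
  - exact: measurable_cst.
  - apply: aeW => x _; apply: cvg_near_cst; near=> n.
    rewrite /hinge; congr EFin; apply/max_idPl.
    by rewrite subr_le0; near: n; exact: nbhs_infty_ger.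
  - exact: integrable_abse.
  - apply: aeW => x n _; rewrite lee_fin ger0_norm ?hinge_ge0//.
    by apply: hinge_le => //; have := ler_norm x; have := @ler0n R n; lra.
  rewrite integral_cst// mul0e => /fine_cvgP[_].
  move=> /cvgrPdist_le /(_ _ e0)[N _ /(_ N (leqnn N))] /=.
  rewrite sub0r normrN => H; exists N%:R => t Nt.
  apply: le_trans (le_trans (ler_norm _) H); apply: le_Rintegral => //.
  - exact: integrable_hinge.
  - exact: integrable_hinge.
  - by move=> x _; apply: hinge_le (hinge_ge0 _ _) _; have := hinge_ge N%:R x; lra.
pose f n x := hinge (- n%:R) x + (- n%:R + (- 1) * x).
have int_f n : P.-integrable [set: R] (EFin \o f n).
  have -> : EFin \o f n = ((EFin \o hinge (- n%:R)) \+
    (EFin \o (fun x => - n%:R + (- 1) * x)%R))%E by [].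
  by apply: integrableD => //; [exact: integrable_hinge|exact: integrable_affine].
have [|||||_ _] := @dominated_convergence _ R R P _ measurableT
    (fun n x => (f n x)%:E) (cst 0%E) (fun x => `|x%:E|%E).
- by move=> n; exact: (measurable_int P (int_f n)).
- exact: measurable_cst.
- apply: aeW => x _; apply: cvg_near_cst; near=> n.
  rewrite /f /hinge (max_idPr _); first by congr EFin; lra.
  rewrite subr_ge0 lerNl; near: n; exact: nbhs_infty_ger.
- exact: integrable_abse.
- apply: aeW => x n _; rewrite lee_fin; have n0 := @ler0n R n.
  have h1 := hinge_ge (- n%:R) x; rewrite ger0_norm /f; last by lra.
  suff : hinge (- n%:R) x <= `|x| + n%:R + x by lra.
  by apply: hinge_le; have := ler_norm x; have := ler_norm (- x); rewrite normrN; lra.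
rewrite integral_cst// mul0e => /fine_cvgP[_].
move=> /cvgrPdist_le /(_ _ e0)[N _ /(_ N (leqnn N))] /=.
rewrite sub0r normrN => H; exists (- N%:R) => t Nt.
have {H} := le_trans (ler_norm _) H.
rewrite -[X in X <= _]/(\int[P]_x f N x) RintegralD//;
  [|exact: integrable_hinge|exact: integrable_affine].
rewrite mean_affine// -/(call P _) => H.
suff : call P t <= call P (- N%:R) + (- N%:R - t) by lra.
have -> : call P (- N%:R) + (- N%:R - t) = \int[P]_x (hinge (- N%:R) x + ((- N%:R - t) + 0 * x)).
  rewrite RintegralD ?mean_affine//; first by rewrite /call; lra.
    exact: integrable_hinge.
  exact: integrable_affine.
apply: le_Rintegral => //; first exact: integrable_hinge.
  have -> : EFin \o (fun x => (hinge (- N%:R) x + ((- N%:R - t) + 0 * x))) =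
   ((EFin \o hinge (- N%:R)) \+ (EFin \o (fun x => (- N%:R - t) + 0 * x)%R))%E by [].
  by apply: integrableD => //; [exact: integrable_hinge|exact: integrable_affine].
by move=> x _; apply: hinge_le; have := hinge_ge (- N%:R) x; have := hinge_ge0 (- N%:R) x; lra.
Unshelve. all: by end_near. Qed.

Lemma call_function_call P : finite_moment 1 P -> call_function (mean P) (call P).
Proof.
move=> iP; have [l1 l2] := call_limits iP; split => //; first exact: cvx_call.
by move=> t; apply: hinge_le; [exact: call_measure_ge0|exact: call_measure_ge_mean].
Qed.

(** The increments of t |-> hinge t x are bounded in x.  They relate P to a
    call function before P is known to have a first moment. *)
Lemma integrable_hingeB P s t :
  P.-integrable [set: R] (EFin \o (fun x => hinge t x - hinge s x)).
Proof.
have := finite_measure_integrable_cst P (t - s) measurableT.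
apply: le_integrable => //.
  by apply/measurable_EFinP; apply: measurable_funB; exact: measurable_hinge.
move=> x _; rewrite /= lee_fin /hinge.
have h1 := ler_norm (t - s); have := ler_norm (- (t - s)); rewrite normrN => h2.
by rewrite ler_norml; case: (leP 0 (x - t)) => ?; case: (leP 0 (x - s)) => ?;
  apply/andP; split; lra.
Qed.

Lemma Rintegral_affine_indic P (A : set R) c : measurable A ->
  P.-integrable [set: R] (EFin \o (fun x => c * (\1_A x - 1))) /\
  \int[P]_x (c * (\1_A x - 1)) = c * (fine (P A) - 1).
Proof.
move=> mA; have iA := integrable_indic P mA.
have i1 := finite_measure_integrable_cst P 1 measurableT.
have iB : P.-integrable [set: R] (EFin \o (fun x => \1_A x - 1)).
  have -> : EFin \o (fun x => \1_A x - 1) = ((EFin \o \1_A) \- (EFin \o cst 1%R))%E by [].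
  exact: integrableB.
split.
  have -> : EFin \o (fun x => c * (\1_A x - 1)) =
    (fun x => c%:E * (EFin \o (fun x => \1_A x - 1)%R) x)%E by [].
  exact: integrableZl.
rewrite RintegralZl// RintegralB// Rintegral_probability_cst.
by rewrite /Rintegral integral_indic// setIT.
Qed.

(** The slope of t |-> hinge t x is -1 before x and 0 after it. *)
Lemma hingeB_cdf P s t : s < t ->
  (t - s) * (rcdf P s - 1) <= \int[P]_x (hinge t x - hinge s x) <= (t - s) * (rcdf P t - 1).
Proof.
move=> st.
have [i1 <-] := @Rintegral_affine_indic P `]-oo, s]%classic (t - s) (measurable_itv _).
have [i2 <-] := @Rintegral_affine_indic P `]-oo, t]%classic (t - s) (measurable_itv _).
apply/andP; split; apply: le_Rintegral => //; try exact: integrable_hingeB.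
  move=> x _; rewrite indicE mem_setE in_itv/= /hinge.
  by case: (leP x s) => /= ?; case: (leP 0 (x - t)) => ?; case: (leP 0 (x - s)) => ?; lra.
move=> x _; rewrite indicE mem_setE in_itv/= /hinge.
by case: (leP x t) => /= ?; case: (leP 0 (x - t)) => ?; case: (leP 0 (x - s)) => ?; lra.
Qed.

End call_of_measure.

(** * Measures with a prescribed call function *)

Section realization.
Context {R : realType}.
Implicit Types (P Q : probability R R) (h F g : R -> R) (m r s t u x y e : R).

(** When [s, t] is cut into n equal pieces, the increments of g and h over each
    piece are caught between the same two bounds; the gaps between these bounds
    add up to (t - s) (F t - F s) / n. *)
Lemma eq_increments F g h :
  (forall s t, s < t -> (t - s) * F s <= g t - g s <= (t - s) * F t) ->
  (forall s t, s < t -> (t - s) * F s <= h t - h s <= (t - s) * F t) ->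
  forall s t, s < t -> g t - g s = h t - h s.
Proof.
move=> gF hF s t st.
have step n d : 0 < d ->
    `|(g (s + d *+ n) - h (s + d *+ n)) - (g s - h s)| <= d * (F (s + d *+ n) - F s).
  move=> d0; elim: n => [|n]; first by rewrite mulr0n !addr0 !subrr normr0 mulr0.
  rewrite mulrSr; set u := s + d *+ n => IH.
  have -> : s + (d *+ n + d) = u + d by rewrite /u; lra.
  have /andP[h1 h2] := gF u (u + d) ltac:(lra).
  have /andP[h3 h4] := hF u (u + d) ltac:(lra).
  move: IH; rewrite !ler_norml => /andP[h5 h6]; apply/andP; split; lra.
apply/eqP; rewrite -subr_eq0 -normr_le0 leNgt; apply/negP => A0.
(* the gap between the two increments over [s, t] *)
set A := `|_| in A0.
pose C := (t - s) * (F t - F s).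
have CA n : A *+ n.+1 <= C.
  have n0 : (0 : R) < n.+1%:R by rewrite ltr0n.
  have := step n.+1 ((t - s) / n.+1%:R) ltac:(rewrite divr_gt0//; lra).
  have -> : s + ((t - s) / n.+1%:R) *+ n.+1 = t by rewrite -mulr_natr divfK ?gt_eqF//; lra.
  have -> : (g t - h t) - (g s - h s) = (g t - g s) - (h t - h s) by lra.
  by rewrite -/A mulrAC ler_pdivlMr// mulr_natr.
have [N] : exists N : nat, C / A < N%:R by exists (Num.truncn (C / A)).+1; exact: truncnS_gt.
have := CA N; rewrite mulrS -mulr_natr ltr_pdivrMr// => ? ?; lra.
Qed.

Lemma call_function_mean_unique m m' h : call_function m h -> call_function m' h ->
  m = m'.
Proof.
wlog : m m' / m < m' => [H hm hm'|mm' hm hm'].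
  have [mm'|mm'|//] := ltgtP m m'; first exact: H.
  by apply/esym; exact: H.
have [T hT] := call_small_left hm (e := (m' - m) / 2) ltac:(lra).
by have := hT T (lexx _); have := call_ge_mean hm' T; lra.
Qed.

Lemma mean_of_call m h P : finite_moment 1 P -> call P = h -> call_function m h ->
  mean P = m.
Proof.
move=> fP <- mh; apply: call_function_mean_unique mh; exact: call_function_call.
Qed.

Section of_cdf.
Variables (m : R) (h : R -> R) (P : probability R R).
Hypothesis mh : call_function m h.
Hypothesis Ph : forall t, rcdf P t = 1 + rder h t.

Let hingeB_eq s t : s < t -> \int[P]_x (hinge t x - hinge s x) = h t - h s.
Proof.
pose g t := \int[P]_x (hinge t x - hinge 0 x).
have gE u v : g v - g u = \int[P]_x (hinge v x - hinge u x).
  rewrite /g -RintegralB//; [|exact: integrable_hingeB..].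
  by apply: eq_Rintegral => x _; lra.
rewrite -gE; apply: (@eq_increments (rder h)) => u v uv.
  rewrite gE; have := hingeB_cdf P uv; rewrite !Ph.
  by rewrite !(addrC 1) !addrK.
by apply/andP; split; [apply: rder_le|apply: rder_ge] => //; exact: call_cvx mh.
Qed.

(** The increments of \int hinge t dP and of h agree, since both are governed
    by the same distribution function; then let n go to +oo in
    hinge s - hinge (s + n), which increases to hinge s. *)
Lemma integral_hinge_of_cdf s : (\int[P]_x (hinge s x)%:E = (h s)%:E)%E.
Proof.
pose f n x : R := hinge s x - hinge (s + n%:R) x.
have : (\int[P]_x (f n x)%:E @[n --> \oo] --> \int[P]_x (hinge s x)%:E)%E.
  have -> : (\int[P]_x (hinge s x)%:E = \int[P]_x limn (fun n => (f n x)%:E))%E.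
    apply: eq_integral => x _; apply/esym/cvg_lim => //; apply: cvg_near_cst; near=> n.
    rewrite /f {2}/hinge (max_idPl _) ?subr0//.
    by rewrite subr_le0 -lerBlDl; near: n; exact: nbhs_infty_ger.
  apply: cvg_monotone_convergence => //.
  - by move=> n; apply/measurable_EFinP; apply: measurable_funB; exact: measurable_hinge.
  - move=> n x _; rewrite lee_fin /f subr_ge0; apply: hinge_le (hinge_ge0 _ _) _.
    by have := hinge_ge s x; have := @ler0n R n; lra.
  - move=> x _ i j ij; rewrite lee_fin /f lerD2l lerN2.
    apply: hinge_le (hinge_ge0 _ _) _; have := hinge_ge (s + i%:R) x.
    have : i%:R <= j%:R :> R by rewrite ler_nat.
    lra.
suff : (\int[P]_x (f n x)%:E @[n --> \oo] --> (h s)%:E)%E by move=> /[swap]; apply: cvg_unique.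
rewrite -cvg_shiftS/=.
have E n : (\int[P]_x (f n.+1 x)%:E = (h s - h (s + n.+1%:R))%:E)%E.
  have n0 : 0 < n.+1%:R :> R by rewrite ltr0n.
  have i1 := integrable_hingeB P (s + n.+1%:R) s.
  have -> : (h s - h (s + n.+1%:R)) = \int[P]_x f n.+1 x.
    have := @hingeB_eq s (s + n.+1%:R) ltac:(lra) => H.
    have -> : h s - h (s + n.+1%:R) = (-1) * (h (s + n.+1%:R) - h s) by lra.
    rewrite -H -RintegralZl//; last exact: integrable_hingeB.
    by apply: eq_Rintegral => x _; rewrite /f; lra.
  by rewrite /Rintegral fineK//; exact: integrable_fin_num.
under eq_cvg do rewrite E.
apply/cvg_EFin; first by near=> n.
apply/cvgrPdist_le => e e0.
have [T hT] := call_small mh e0.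
near=> n.
have := hT (s + n.+1%:R); have -> : T <= s + n.+1%:R.
  rewrite -lerBlDl; apply: (@le_trans _ _ n%:R); last by rewrite ler_nat.
  by near: n; exact: nbhs_infty_ger.
move=> /(_ isT) H; rewrite ger0_norm; have := call_ge0 mh (s + n.+1%:R); rewrite /=; lra.
Unshelve. all: by end_near. Qed.

(** The positive part has integral h 0.  The negative part is the increasing
    limit of min(n, max(0, -x)), written with increments of hinge, whose
    integral h 0 - (h (- n) - n) is at most h 0 - m. *)
Lemma finite_moment_of_cdf : finite_moment 1 P.
Proof.
pose f n x : R := hinge 0 x - hinge (- n%:R) x + n%:R.
have mf n : measurable_fun [set: R] (EFin \o f n).
  apply/measurable_EFinP; apply: measurable_funD => //.
  by apply: measurable_funB; exact: measurable_hinge.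
have : (\int[P]_x (f n x)%:E @[n --> \oo] --> \int[P]_x (hinge 0 (- x))%:E)%E.
  have -> : (\int[P]_x (hinge 0 (- x))%:E = \int[P]_x limn (fun n => (f n x)%:E))%E.
    apply: eq_integral => x _; apply/esym/cvg_lim => //; apply: cvg_near_cst; near=> n.
    have nx : - x <= n%:R by near: n; exact: nbhs_infty_ger.
    congr EFin; rewrite /f /hinge (max_idPr (_ : 0 <= x - - n%:R)); last by lra.
    by case: (leP 0 (x - 0)) => ?; case: (leP 0 (- x - 0)) => ?; lra.
  apply: cvg_monotone_convergence => //.
  - move=> n x _; rewrite lee_fin /f.
    suff : hinge (- n%:R) x <= hinge 0 x + n%:R by lra.
    by apply: hinge_le; have := hinge_ge 0 x; have := hinge_ge0 0 x; have := @ler0n R n; lra.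
  - move=> x _ i j ij; rewrite lee_fin /f.
    have : i%:R <= j%:R :> R by rewrite ler_nat.
    move=> ij'; suff : hinge (- j%:R) x <= hinge (- i%:R) x + (j%:R - i%:R) by lra.
    by apply: hinge_le; have := hinge_ge (- i%:R) x; have := hinge_ge0 (- i%:R) x; lra.
have fle n : (\int[P]_x (f n.+1 x)%:E <= (h 0 - m)%:E)%E.
  have n0 : 0 < n.+1%:R :> R by rewrite ltr0n.
  have i1 := integrable_hingeB P (- n.+1%:R) 0.
  have i2 := finite_measure_integrable_cst P (n.+1%:R : R) measurableT.
  have -> : (\int[P]_x (f n.+1 x)%:E = (\int[P]_x f n.+1 x)%:E)%E.
    rewrite /Rintegral fineK//; apply: integrable_fin_num => //.
    have -> : (fun x => (f n.+1 x)%:E) =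
      ((EFin \o (fun x => hinge 0 x - hinge (- n.+1%:R) x)%R) \+ (EFin \o cst n.+1%:R%R))%E by [].
    by apply: (integrableD measurableT); [exact: i1|exact: i2].
  rewrite lee_fin (RintegralD measurableT i1 i2).
  rewrite Rintegral_probability_cst hingeB_eq; last by lra.
  by have := call_ge_mean mh (- n.+1%:R); lra.
rewrite -cvg_shiftS/= => fc.
have neg : (\int[P]_x (hinge 0 (- x))%:E <= (h 0 - m)%:E)%E.
  have <- := cvg_lim (@ereal_hausdorff R) fc.
  by apply: lime_le; [apply/cvg_ex; eexists; exact: fc|exact: nearW].
rewrite /finite_moment/=.
have -> : (\int[P]_x (`|x| `^ 1)%:E = \int[P]_x ((hinge 0 x)%:E + (hinge 0 (- x))%:E))%E.
  apply: eq_integral => x _; rewrite powRr1// -EFinD; congr EFin.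
  rewrite /hinge; have [x0|x0] := leP 0 x; [rewrite ger0_norm//|rewrite ltr0_norm//];
    by case: (leP 0 (x - 0)) => ?; case: (leP 0 (- x - 0)) => ?; lra.
rewrite ge0_integralD//.
- rewrite integral_hinge_of_cdf; apply: lte_add_pinfty; first exact: ltry.
  exact: le_lt_trans neg (ltry _).
- by move=> x _; rewrite lee_fin hinge_ge0.
- by apply/measurable_EFinP; exact: measurable_hinge.
- by move=> x _; rewrite lee_fin hinge_ge0.
- apply/measurable_EFinP; apply: (measurableT_comp (measurable_hinge 0)) => //.
Unshelve. all: by end_near. Qed.

End of_cdf.

(** With [call_function_call], this identifies the abstract call functions of
    mean m with those of the measures of mean m. *)
Theorem call_function_realized m h : call_function m h ->
  exists P, [/\ finite_moment 1 P, mean P = m & call P = h].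
Proof.
move=> mh; have [P HP] := exists_probability_cdf mh.
have Ph t : rcdf P t = 1 + rder h t by rewrite /rcdf HP.
have f1 := finite_moment_of_cdf mh Ph.
have Eh : call P = h.
  apply/funext => t; apply: EFin_inj.
  by rewrite callE// (integral_hinge_of_cdf mh Ph).
by exists P; split => //; exact: mean_of_call mh.
Qed.

Lemma rcdf_right_continuous P : right_continuous (rcdf P).
Proof.
move=> t; apply: fine_cvg; rewrite rcdfE.
pose X := HB.pack_for {mfun R >-> R} (idfun : R -> R)
  (@isMeasurableFun.Build _ _ _ _ (idfun : R -> R) (@measurable_id _ _ setT)).
exact: (@cdf_right_continuous _ _ _ P X t).
Qed.

Lemma call_slope_cdf P s t : finite_moment 1 P -> s < t ->
  (t - s) * (rcdf P s - 1) <= call P t - call P s <= (t - s) * (rcdf P t - 1).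
Proof.
by move=> fP /(hingeB_cdf P); rewrite RintegralB//; exact: integrable_hinge.
Qed.

(** Besides uniqueness, this yields the measurability of x |-> rcdf (p x) t from
    that of the call functions of the measures p x. *)
Lemma rcdf_lim P t : finite_moment 1 P ->
  1 + (call P (t + n.+1%:R^-1) - call P t) * n.+1%:R @[n --> \oo] --> rcdf P t.
Proof.
move=> fP; apply/cvgrPdist_le => e e0.
have /cvgrPdist_le/(_ _ e0) := @rcdf_right_continuous P t.
rewrite /at_right near_withinE => /nbhs_ballP[d /= d0 H].
near=> n.
have n0 : 0 < n.+1%:R^-1 :> R by rewrite invr_gt0 ltr0n.
have nd : n.+1%:R^-1 < d by near: n; exact: near_infty_natSinv_lt (PosNum d0).
have tn : t < t + n.+1%:R^-1 by rewrite ltrDl.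
have := H (t + n.+1%:R^-1) _ tn; rewrite /ball/= opprD addrA subrr sub0r normrN.
rewrite gtr0_norm// => /(_ nd); rewrite ler_norml => /andP[h1 h2].
have := call_slope_cdf fP tn.
have -> : t + n.+1%:R^-1 - t = n.+1%:R^-1 by rewrite addrAC subrr add0r.
rewrite ![n.+1%:R^-1 * _]mulrC ler_pdivrMr ?ltr0n// ler_pdivlMr ?ltr0n// => /andP[h3 h4].
rewrite ler_norml; apply/andP; split; lra.
Unshelve. all: by end_near. Qed.

Lemma eq_probability_call P Q : finite_moment 1 P -> finite_moment 1 Q ->
  call P = call Q -> forall A, measurable A -> P A = Q A.
Proof.
move=> fP fQ PQ.
have F t : rcdf P t = rcdf Q t.
  have lP := @rcdf_lim P t fP; rewrite PQ in lP.
  exact: (cvg_unique _ lP (@rcdf_lim Q t fQ)).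
pose g n : set R := `](- n%:R), +oo[%classic.
have GI : setI_closed (@RGenOInfty.G R).
  move=> _ _ [x ->] [y ->]; exists (Num.max x y).
  by apply/seteqP; split => z /=; rewrite !in_itv/= !andbT gt_max => /andP.
have Gg n : RGenOInfty.G (g n) by exists (- n%:R).
have gT : \bigcup_k g k = [set: R].
  rewrite -subTset => x _; exists (Num.truncn (- x)).+1 => //=.
  by rewrite /g/= in_itv/= andbT ltrNl truncnS_gt.
have PQG B : RGenOInfty.G B -> P B = Q B by move=> [x ->]; rewrite !probability_tail F.
have Pfin k : (P (g k) < +oo)%E by rewrite -ge0_fin_numE// fin_num_measure//; exact: measurable_itv.
exact: (@measure_unique _ R R (@RGenOInfty.G R) g (RGenOInfty.measurableE R) GI Gg gT P Q PQG Pfin).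
Qed.

End realization.

(** * Joint law and mixture along a kernel *)

Section joint.
Context {R : realType}.
Implicit Types (P Q : probability R R).

Section joint_measure.
Variables (P : probability R R) (k : R.-pker R ~> R).

(** The law of (x, y) with x fixed and y distributed along k x.  The dummy
    argument of type unit is for [integral_kcomp], which composes a kernel with
    a kernel on a product. *)
Definition graph_kernel (ux : unit * R) : {measure set (R * R) -> \bar R} :=
  measure_function_pushforward__canonical__measure_function_Measure
    (k ux.2) (pair1_measurable ux.2).

Let measurable_graph_kernel A : measurable A ->
  measurable_fun [set: unit * R] (graph_kernel ^~ A).
Proof.
move=> mA; rewrite /graph_kernel /pushforward.
have -> : (fun ux : unit * R => k ux.2 ((fun y : R => (ux.2, y)) @^-1` A)) =
  (fun x => k x (xsection A x)) \o snd.
  by apply/funext => ux/=; rewrite xsectionE.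
apply: measurableT_comp => //.
by apply: measurable_fun_xsection_finite_kernel; rewrite inE.
Qed.

HB.instance Definition _ := isKernel.Build _ _ (unit * R)%type (R * R)%type R
  graph_kernel measurable_graph_kernel.

Let graph_kernelT ux : graph_kernel ux [set: R * R] = 1%E.
Proof. exact: prob_kernel. Qed.

HB.instance Definition _ := Kernel_isProbability.Build _ _ _ _ _ graph_kernel graph_kernelT.

Definition point_kernel (_ : unit) : {measure set R -> \bar R} := P.

Let measurable_point_kernel A : measurable A ->
  measurable_fun [set: unit] (point_kernel ^~ A).
Proof. by move=> mA; exact: measurable_cst. Qed.

HB.instance Definition _ := isKernel.Build _ _ _ _ R
  point_kernel measurable_point_kernel.

Let point_kernelT u : point_kernel u [set: R] = 1%E.
Proof. exact: probability_setT. Qed.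

HB.instance Definition _ := Kernel_isProbability.Build _ _ _ _ _ point_kernel point_kernelT.

Let joint_measure : {measure set (R * R) -> \bar R} :=
  mkcomp point_kernel graph_kernel tt.

Let joint_measureE A : joint_measure A = (\int[P]_x k x (xsection A x))%E.
Proof.
rewrite /joint_measure /mkcomp /kcomp/=; apply: eq_integral => x _.
by rewrite /graph_kernel /pushforward/= xsectionE.
Qed.

Let joint_measureT : joint_measure [set: R * R] = 1%E.
Proof.
rewrite joint_measureE; under eq_integral do rewrite xsectionE/= preimage_setT prob_kernel.
by rewrite integral_cst//= probability_setT mule1.
Qed.

(** The measure P(dx) k(x, dy). *)
Definition joint : probability (R * R)%type R :=
  HB.pack_for (probability (R * R)%type R) (Measure.sort joint_measure)
    (Measure_isProbability.Build _ _ _ joint_measure joint_measureT).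

Lemma jointE A : joint A = (\int[P]_x k x (xsection A x))%E.
Proof. exact: joint_measureE. Qed.

Lemma integral_joint (f : R * R -> \bar R) :
  measurable_fun [set: R * R] f -> (forall z, 0 <= f z)%E ->
  (\int[joint]_z f z = \int[P]_x \int[k x]_y f (x, y))%E.
Proof.
move=> mf f0; transitivity (\int[joint_measure]_z f z)%E; first by [].
rewrite /joint_measure integral_kcomp//=.
apply: eq_integral => x _; rewrite ge0_integral_pushforward//.
Qed.

Let snd_mfun := HB.pack_for {mfun (R * R)%type >-> R} (snd : R * R -> R)
  (@isMeasurableFun.Build _ _ (R * R)%type R snd measurable_snd).

(** The law of y under P(dx) k(x, dy). *)
Definition mixture : probability R R := distribution joint snd_mfun.

Lemma mixtureE A : mixture A = (\int[P]_x k x A)%E.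
Proof.
transitivity (joint (snd @^-1` A)); first by [].
rewrite jointE.
apply: eq_integral => x _; congr (k x _).
by apply/seteqP; split => y /=; rewrite /xsection/= inE.
Qed.

Lemma integral_mixture (f : R -> \bar R) :
  measurable_fun [set: R] f -> (forall y, 0 <= f y)%E ->
  (\int[mixture]_y f y = \int[P]_x \int[k x]_y f y)%E.
Proof.
move=> mf f0; rewrite ge0_integral_distribution// integral_joint//.
  by apply: measurableT_comp => //; exact: measurable_snd.
by move=> z; exact: f0.
Qed.

End joint_measure.

End joint.

(** * Splitting a call function into call functions of prescribed means *)

Section decomposition.
Context {R : realType}.
Implicit Types (P Q : probability R R).

(** The limits f k of u k n in n have integrals that are arbitrarily small, so
    the infimum of the f k, which is nonnegative, has integral 0. *)
Lemma ae_small P (u : nat -> nat -> R -> R) :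
  (forall k n, measurable_fun [set: R] (u k n)) ->
  (forall k n x, 0 <= u k n x) ->
  (forall k x, nondecreasing_seq (u k ^~ x)) ->
  (forall e, 0 < e -> exists k, forall n, (\int[P]_x (u k n x)%:E <= e%:E)%E) ->
  {ae P, forall x, forall e, 0 < e -> exists k, forall n, u k n x <= e}.
Proof.
move=> mu u0 ud ue.
pose f k x : \bar R := limn (fun n => (u k n x)%:E).
have cu k x : cvgn (fun n => (u k n x)%:E).
  by apply: ereal_nondecreasing_is_cvgn => i j ij; rewrite lee_fin; exact: ud.
have mf k : measurable_fun [set: R] (f k).
  apply: (emeasurable_fun_cvg (fun n x => (u k n x)%:E)) => [n|x _].
    by apply/measurable_EFinP; exact: mu.
  exact: cu.
have uf k n x : ((u k n x)%:E <= f k x)%E.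
  apply: lime_ge; first exact: cu.
  by exists n => // m /= nm; rewrite lee_fin; exact: ud.
have f0 k x : (0 <= f k x)%E by apply: le_trans (uf k 0%N x); rewrite lee_fin.
pose g x := einfs (f ^~ x) 0%N.
have mg : measurable_fun [set: R] g by exact: measurable_fun_einfs.
have g0 x : (0 <= g x)%E.
  by apply: le_ereal_inf_tmp => _ [k _ <-].
have gf k x : (g x <= f k x)%E by apply: ge_ereal_inf; exists (f k x) => //; exists k.
have ig0 : (\int[P]_x g x = 0)%E.
  apply/eqP; rewrite eq_le integral_ge0 ?andbT//; apply/lee_addgt0Pr => e e0.
  have [k hk] := ue _ e0; rewrite add0e.
  apply: (@le_trans _ _ (\int[P]_x f k x)%E); first exact: ge0_le_integral.
  rewrite monotone_convergence//.
  - apply: lime_le; last exact: nearW.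
    apply: ereal_nondecreasing_is_cvgn => i j ij; apply: ge0_le_integral => //.
    + by move=> x _; rewrite lee_fin.
    + by apply/measurable_EFinP; exact: mu.
    + by apply/measurable_EFinP; exact: mu.
    + by move=> x _; rewrite lee_fin; exact: ud.
  - by move=> n; apply/measurable_EFinP; exact: mu.
  - by move=> n x _; rewrite lee_fin.
  - by move=> x _ i j ij; rewrite lee_fin; exact: ud.
have : (\int[P]_x `|g x| = 0)%E by under eq_integral do rewrite gee0_abs//.
move/(ae_eq_integral_abs P measurableT mg); apply: filterS => x /(_ I) /= gx e e0.
have : (g x < e%:E)%E by rewrite gx lte_fin.
move=> /ereal_inf_lt[_ [k _ <-] fke]; exists k => n.
by rewrite -lee_fin; apply: le_trans (uf k n x) (ltW fke).
Qed.

Lemma measurable_bridging (I : nat -> R * R) n t :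
  measurable_fun [set: R] (fun x => bridging I (hinge ^~ x) n t).
Proof.
elim: n t => [|n IH] t /=; first exact: measurable_hinge.
have [H|H] := boolP ((I n).1 < t < (I n).2); last first.
  by apply: eq_measurable_fun (IH t) => x _; rewrite /bridge (negbTE H).
apply: (eq_measurable_fun (fun x =>
    (((I n).2 - t) * bridging I (hinge ^~ x) n (I n).1 +
     (t - (I n).1) * bridging I (hinge ^~ x) n (I n).2) / ((I n).2 - (I n).1))) => [x _|].
  by rewrite /bridge H.
apply: measurable_funM => //; apply: measurable_funD;
  by apply: measurable_funM => //; exact: IH.
Qed.

(** Taking a chord over a fixed interval is linear in the function, so it
    commutes with the average over x. *)
Lemma Rintegral_bridging P (I : nat -> R * R) n t : finite_moment 1 P ->
  P.-integrable [set: R] (EFin \o (fun x => bridging I (hinge ^~ x) n t)) /\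
  \int[P]_x bridging I (hinge ^~ x) n t = bridging I (call P) n t.
Proof.
move=> fP; elim: n t => [|n IH] t /=; first by split => //; exact: integrable_hinge.
have [H|H] := boolP ((I n).1 < t < (I n).2); last first.
  have -> : (fun x => bridge (I n).1 (I n).2 (bridging I (hinge ^~ x) n) t) =
    (fun x => bridging I (hinge ^~ x) n t).
    by apply/funext => x; rewrite /bridge (negbTE H).
  by rewrite /bridge (negbTE H); exact: IH.
rewrite /bridge H; set a := (I n).1; set b := (I n).2.
have -> : (fun x => ((b - t) * bridging I (hinge ^~ x) n a +
                     (t - a) * bridging I (hinge ^~ x) n b) / (b - a)) =
  (fun x => ((b - t) / (b - a)) * bridging I (hinge ^~ x) n a +
            ((t - a) / (b - a)) * bridging I (hinge ^~ x) n b).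
  by apply/funext => x; lra.
have iZ c s : P.-integrable [set: R]
    (EFin \o (fun x => c * bridging I (hinge ^~ x) n s)).
  have -> : EFin \o (fun x => c * bridging I (hinge ^~ x) n s) =
    (fun x => c%:E * (EFin \o (fun x => bridging I (hinge ^~ x) n s)) x)%E by [].
  by apply: integrableZl => //; exact: (IH s).1.
split; first exact: (integrableD measurableT (iZ _ _) (iZ _ _)).
rewrite (RintegralD measurableT (iZ _ _) (iZ _ _)).
rewrite !RintegralZl//; [|exact: (IH _).1..].
by rewrite !(IH _).2; lra.
Qed.

Lemma integral_bridging P (I : nat -> R * R) n t : finite_moment 1 P ->
  (\int[P]_x (bridging I (hinge ^~ x) n t)%:E = (bridging I (call P) n t)%:E)%E.
Proof.
move=> fP; have [i <-] := Rintegral_bridging I n t fP.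
by rewrite /Rintegral fineK//; exact: integrable_fin_num.
Qed.

(** Averaged over x, the tails on both sides are at most the tails of q, which
    vanish; [ae_small] turns this into a statement for almost every x. *)
Lemma ae_bridging_tails P q (I : nat -> R * R) :
  finite_moment 1 P -> call_function (mean P) q ->
  (forall n t, bridging I (call P) n t <= q t) ->
  {ae P, forall x,
    (forall e, 0 < e -> exists s, forall n, bridging I (hinge ^~ x) n s <= e) /\
    (forall e, 0 < e -> exists s, forall n,
       bridging I (hinge ^~ x) n s + s <= x + e)}.
Proof.
move=> fP mq Iq; pose U n x t := bridging I (hinge ^~ x) n t.
have cU n x : call_function x (U n x).
  by apply: call_function_bridging; exact: call_function_hinge.
have Ud x t : nondecreasing_seq (fun n => U n x t).
  exact: bridging_nd (call_function_hinge x).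
have right_tail : {ae P, forall x, forall e, 0 < e ->
    exists k, forall n, U n x k%:R <= e}.
  apply: (@ae_small P (fun k n x => U n x k%:R)).
  - by move=> k n; exact: measurable_bridging.
  - by move=> k n x; exact: call_ge0 (cU n x) _.
  - by move=> k x; exact: Ud.
  - move=> e e0; have [T hT] := call_small mq e0.
    exists (Num.truncn T).+1 => n; rewrite integral_bridging// lee_fin.
    by apply: le_trans (Iq _ _) (hT _ _); apply: ltW; exact: truncnS_gt.
have left_tail : {ae P, forall x, forall e, 0 < e ->
    exists k, forall n, U n x (- k%:R) + (- k%:R + (- 1) * x) <= e}.
  apply: (@ae_small P (fun k n x => U n x (- k%:R) + (- k%:R + (- 1) * x))).
  - move=> k n; apply: measurable_funD; first exact: measurable_bridging.
    by apply: cvx_measurable; exact: cvx_affine.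
  - by move=> k n x; have := call_ge_mean (cU n x) (- k%:R); lra.
  - by move=> k x i j ij; rewrite lerD2r; exact: Ud.
  - move=> e e0; have [T hT] := call_small_left mq e0.
    exists (Num.truncn (- T)).+1 => n; set k := _.+1.
    have [iUk eUk] := Rintegral_bridging I n (- k%:R) fP.
    have ia := integrable_affine (- 1) (- k%:R) fP.
    have -> : (\int[P]_x (U n x (- k%:R) + (- k%:R + (- 1) * x))%:E =
      (\int[P]_x (U n x (- k%:R) + (- k%:R + (- 1) * x)))%:E)%E.
      rewrite /Rintegral fineK//; apply: integrable_fin_num => //.
      exact: (integrableD measurableT iUk ia).
    rewrite (RintegralD measurableT iUk ia) eUk mean_affine// lee_fin.
    have kT : - k%:R <= T by rewrite lerNl; apply: ltW; exact: truncnS_gt.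
    by have := hT _ kT; have := Iq n (- k%:R); lra.
apply: filterS2 right_tail left_tail => x h1 h2.
split=> e; first by move=> /h1[k hk]; exists k%:R.
by move=> /h2[k hk]; exists (- k%:R) => n; have := hk n; rewrite /U; lra.
Qed.

(** The chords that raise call P to q are applied to the call functions of all
    point masses, and V x is the limit.  On the null set where mass may escape,
    the point mass itself is kept. *)
Lemma call_decomposition P q : finite_moment 1 P -> call_function (mean P) q ->
  (forall t, call P t <= q t) ->
  exists V : R -> R -> R, [/\ forall x, call_function x (V x),
    forall t, measurable_fun [set: R] (V ^~ t) &
    forall t, (\int[P]_x (V x t)%:E = (q t)%:E)%E].
Proof.
move=> fP mq Pq; have mP := call_function_call fP.
have [I [Iq Iqe]] := exists_bridging mP mq Pq.
pose U n x t := bridging I (hinge ^~ x) n t.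
have cU n x : call_function x (U n x).
  by apply: call_function_bridging; exact: call_function_hinge.
have Ud x t : nondecreasing_seq (fun n => U n x t).
  exact: bridging_nd (call_function_hinge x).
have [N [mN PN0 subN]] := ae_bridging_tails fP mq Iq.
have goodN x : x \notin N ->
    (forall t, has_ubound (range (fun n => U n x t))) /\
    call_function x (fun t => sup (range (fun n => U n x t))).
  move=> xN; have [g1 g2] : _ /\ _ :=
    contrapT (fun H => negP xN (mem_set (subN _ H))).
  exact: (call_function_sup (cU ^~ x) g1 g2).
pose f n x t := if x \in N then hinge t x else U n x t.
pose V x t := if x \in N then hinge t x else sup (range (fun n => U n x t)).
have fV x t : f n x t @[n --> \oo] --> V x t.
  rewrite /f /V; case: ifPn => xN; first exact: cvg_cst.
  by apply: nondecreasing_cvgn; [exact: Ud|exact: (goodN x xN).1].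
have mf n t : measurable_fun [set: R] (fun x => f n x t).
  apply: measurable_fun_ifT; [|exact: measurable_hinge|exact: measurable_bridging].
  have NE : (fun x : R => x \in N) @^-1` [set true] = N.
    by apply/seteqP; split => z /= => [/set_mem|/mem_set].
  by apply: (measurable_fun_bool true); rewrite NE setTI.
have f0 n x t : 0 <= f n x t.
  by rewrite /f; case: ifP => // _; [exact: hinge_ge0|exact: call_ge0 (cU n x) t].
exists V; split.
- move=> x; have [xN|xN] := boolP (x \in N).
    have -> : V x = hinge ^~ x by apply/funext => t; rewrite /V xN.
    exact: call_function_hinge.
  have -> : V x = (fun t => sup (range (fun n => U n x t))).
    by apply/funext => t; rewrite /V (negbTE xN).
  exact: (goodN x xN).2.
- by move=> t; apply: (measurable_fun_cvg (h := fun n x => f n x t)) => // x _; exact: fV.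
- move=> t.
  have fVint : (\int[P]_x (f n x t)%:E @[n --> \oo] --> \int[P]_x (V x t)%:E)%E.
    have -> : (\int[P]_x (V x t)%:E = \int[P]_x limn (fun n => (f n x t)%:E))%E.
      apply: eq_integral => x _; apply/esym/cvg_lim => //.
      by apply/cvg_EFin; [exact: nearW|exact: fV].
    apply: cvg_monotone_convergence => //.
    + by move=> n; apply/measurable_EFinP; exact: mf.
    + by move=> n x _; rewrite lee_fin.
    + by move=> x _ i j ij; rewrite lee_fin /f; case: ifP => // _; exact: Ud.
  suff : (\int[P]_x (f n x t)%:E @[n --> \oo] --> (q t)%:E)%E.
    by move: fVint; apply: cvg_unique.
  have E n : (\int[P]_x (f n x t)%:E = (bridging I (call P) n t)%:E)%E.
    rewrite -integral_bridging//; apply: ge0_ae_eq_integral => //.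
    + by apply/measurable_EFinP; exact: mf.
    + by apply/measurable_EFinP; exact: measurable_bridging.
    + by move=> x _; rewrite lee_fin.
    + by move=> x _; rewrite lee_fin; exact: call_ge0 (cU n x) t.
    + exists N; split => // x /= H; apply: contrapT => xN; apply: H => _.
      by rewrite /f; case: ifPn => // /set_mem.
  under eq_cvg do rewrite E.
  apply/cvg_EFin; first exact: nearW.
  apply/cvgrPdist_le => e e0; have [n hn] := Iqe t e e0.
  exists n => // m /= nm; rewrite ger0_norm ?subr_ge0//.
  by have /= := bridging_nd I t mP nm; lra.
Qed.

End decomposition.

(** * Martingale kernels and the convex order *)

Section ge0_integrable.
Local Open Scope ereal_scope.
Context d (T : measurableType d) (R : realType) (mu : {measure set T -> \bar R}).

(** Additivity when only one of the two terms is integrable: used with a convex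
    function minus a tangent line, and the line. *)
Lemma integralD_ge0_integrable (f g : T -> R) :
  measurable_fun [set: T] f -> (forall x, (0 <= f x)%R) ->
  mu.-integrable [set: T] (EFin \o g) ->
  \int[mu]_x (f x + g x)%:E = \int[mu]_x (f x)%:E + \int[mu]_x (g x)%:E.
Proof.
move=> mf f0 ig.
have mEf : measurable_fun [set: T] (EFin \o f) by apply/measurable_EFinP.
have mg : measurable_fun [set: T] (EFin \o g) := measurable_int mu ig.
have [foo|] := ltP (\int[mu]_x (f x)%:E) +oo.
  have if_ : mu.-integrable [set: T] (EFin \o f).
    apply/integrableP; split => //.
    by under eq_integral do rewrite gee0_abs ?lee_fin//.
  exact: (integralD_EFin measurableT if_ ig).
rewrite leye_eq => /eqP foo; rewrite foo addye; last first.
  by have := integrable_fin_num measurableT ig; rewrite fin_numE => /andP[].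
pose h x := (f x + g x)%:E.
have mh : measurable_fun [set: T] h := emeasurable_funD mEf mg.
rewrite integralE.
have neg : \int[mu]_x h^\- x \is a fin_num.
  rewrite ge0_fin_numE; last exact: integral_ge0.
  apply: le_lt_trans (integral_funeneg_lt_pinfty measurableT ig).
  apply: ge0_le_integral => //.
  - exact: measurable_funeneg.
  - exact: measurable_funeneg.
  - move=> x _; rewrite !funenegE /h /= -!EFin_max lee_fin.
    rewrite ge_max; apply/andP; split; last by rewrite le_max lexx orbT.
    by rewrite le_max lerN2 lerDr f0.
suff -> : \int[mu]_x h^\+ x = +oo.
  by rewrite addye//; move: neg; rewrite -fin_numN fin_numE => /andP[].
apply/eqP; rewrite -leye_eq.
have : +oo <= \int[mu]_x h^\+ x + \int[mu]_x (EFin \o g)^\- x.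
  rewrite -foo -ge0_integralD//.
  - apply: ge0_le_integral => //.
    + by move=> x _; rewrite lee_fin.
    + apply: emeasurable_funD; [exact: measurable_funepos|exact: measurable_funeneg].
    + move=> x _; rewrite funeposE funenegE /h /= -!EFin_max -EFinD lee_fin.
      have h1 : (f x + g x <= Num.max (f x + g x) 0)%R by rewrite le_max lexx.
      have h2 : (- g x <= Num.max (- g x) 0)%R by rewrite le_max lexx.
      lra.
  - exact: measurable_funepos.
  - exact: measurable_funeneg.
have /fineK <- := integrable_neg_fin_num measurableT ig.
by case: (\int[mu]_x h^\+ x).
Qed.

End ge0_integrable.

Section convex_order.
Context {R : realType}.
Implicit Types (P Q : probability R R).

Lemma measurable_probability_of_rcdf (p : R -> probability R R) :
  (forall t, measurable_fun [set: R] (fun x => rcdf (p x) t)) ->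
  forall A, measurable A -> measurable_fun [set: R] (fun x => p x A).
Proof.
move=> mF A mA.
pose S : set_system R := [set A | measurable_fun [set: R] (fun x => p x A)].
have mA' : <<s @RGenOInfty.G R >> A.
  have E : (measurable : set (set R)) = <<s @RGenOInfty.G R >> :=
    RGenOInfty.measurableE R.
  by rewrite -E.
apply: (@dynkin_induction _ R (@RGenOInfty.G R) S
  (RGenOInfty.measurableE R) _ _ _ _ _ A mA').
- move=> _ _ [x ->] [y ->]; exists (Num.max x y).
  by apply/seteqP; split => z /=; rewrite !in_itv/= !andbT gt_max => /andP.
- by rewrite /S/=; under eq_fun do rewrite probability_setT; exact: measurable_cst.
- move=> _ [t ->]; rewrite /S/=; under eq_fun do rewrite probability_tail.
  by apply/measurable_EFinP; exact: measurable_funB.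
- move=> B mB; rewrite /S/= => mpB.
  by under eq_fun do rewrite probability_setC//; exact: emeasurable_funB.
- move=> F mF' tF; rewrite /S/= => mpF.
  apply: (emeasurable_fun_cvg (fun n x => \sum_(0 <= i < n) p x (F i))%E) => [n|x _].
    by apply: emeasurable_sum => i; exact: mpF.
  exact: measure_sigma_additive.
Qed.

(** The values of a kernel are mere measures; p presents them as probability
    measures, to which [call] and [mean] apply. *)
Lemma exists_call_kernel (V : R -> R -> R) :
  (forall x, call_function x (V x)) ->
  (forall t, measurable_fun [set: R] (V ^~ t)) ->
  exists (k : R.-pker R ~> R) (p : R -> probability R R),
    (forall x, k x = p x :> {measure set R -> \bar R}) /\
    forall x, [/\ finite_moment 1 (p x), mean (p x) = x & call (p x) = V x].
Proof.
move=> cV mV; have [p Hp] := choice (fun x => call_function_realized (cV x)).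
have mp : forall A, measurable A -> measurable_fun [set: R] (fun x => p x A).
  apply: measurable_probability_of_rcdf => t.
  apply: (measurable_fun_cvg (h := fun n x =>
      1 + (V x (t + n.+1%:R^-1) - V x t) * n.+1%:R)) => [n|x _].
    apply: measurable_funD => //; apply: measurable_funM => //.
    by apply: measurable_funB; exact: mV.
  by have [fp _ <-] := Hp x; exact: rcdf_lim.
pose k0 (x : R) : {measure set R -> \bar R} := p x.
pose mk_mixin := isKernel.Build _ _ _ _ R k0 mp.
pose k1 : R.-ker R ~> R := HB.pack k0 mk_mixin.
pose k : R.-pker R ~> R := HB.pack k0 mk_mixin
  (Kernel_isProbability.Build _ _ _ _ R k1 (fun x => probability_setT (p x))).
by exists k, p.
Qed.

(** The kernel has the call functions V x of [call_decomposition], so its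
    mixture under P has the call function of Q, hence is Q. *)
Theorem strassen P Q : finite_moment 1 P -> finite_moment 1 Q ->
  mean P = mean Q -> (forall t, call P t <= call Q t) ->
  exists k : R.-pker R ~> R, [/\ forall x, (\int[k x]_y y%:E = x%:E)%E,
    forall x, (k x).-integrable [set: R] (EFin \o idfun) &
    forall A, measurable A -> Q A = (\int[P]_x k x A)%E].
Proof.
move=> fP fQ mPQ PQ; have mQ := call_function_call fQ; rewrite -mPQ in mQ.
have [V [cV mV iV]] := call_decomposition fP mQ PQ.
have [k [p [kp Hp]]] := exists_call_kernel cV mV.
have fp x : finite_moment 1 (p x) by have [] := Hp x.
have cp x : call (p x) = V x by have [] := Hp x.
have mp x : mean (p x) = x by have [] := Hp x.
exists k; split => [x|x|A mA].
- by rewrite kp -[in RHS](mp x) meanE.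
- by rewrite kp; apply/finite_moment1P.
pose Q' := mixture P k.
have iQ' f : measurable_fun [set: R] f -> (forall y, 0 <= f y)%E ->
    (\int[Q']_y f y = \int[P]_x \int[p x]_y f y)%E.
  move=> mf f0; rewrite integral_mixture//.
  by apply: eq_integral => x _; rewrite kp.
have cQ' t : (\int[Q']_y (hinge t y)%:E = (call Q t)%:E)%E.
  rewrite iQ'.
  - by rewrite -iV; apply: eq_integral => x _; rewrite -cp callE.
  - by apply/measurable_EFinP; exact: measurable_hinge.
  - by move=> y; rewrite lee_fin hinge_ge0.
have fQ' : finite_moment 1 Q'.
  rewrite /finite_moment/= iQ'; last 2 first.
  - apply/measurable_EFinP; under eq_fun do rewrite powRr1//.
    exact: measurableT_comp.
  - by move=> y; rewrite lee_fin powR_ge0.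
  have iV0 : P.-integrable [set: R] (EFin \o (fun x => V x 0)).
    apply/integrableP; split; first by apply/measurable_EFinP.
    under eq_integral do rewrite gee0_abs ?lee_fin ?(call_ge0 (cV _))//.
    by rewrite iV ltry.
  have i1 := integrable_affine (- 1) 0 fP.
  (* |y| = 2 max(0, y) - y, so its integral under p x is 2 V x 0 - x. *)
  have -> : (\int[P]_x \int[p x]_y (`|y| `^ 1)%:E =
      \int[P]_x (V x 0 + (V x 0 + (0 + (-1) * x)))%:E)%E.
    apply: eq_integral => x _; rewrite -cp; under eq_integral do rewrite powRr1//.
    have iy := finite_moment1P (p x); have {}iy := iy.1 (fp x).
    have ih := integrable_hinge 0 (fp x).
    have ia := integrable_affine (- 1) 0 (fp x).
    have iha : (p x).-integrable [set: R] (EFin \o (fun y => hinge 0 y + (0 + -1 * y))).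
      exact: (integrableD measurableT ih ia).
    transitivity (\int[p x]_y (hinge 0 y + (hinge 0 y + (0 + -1 * y))))%:E.
      rewrite /Rintegral fineK; last first.
        by apply: integrable_fin_num => //; exact: (integrableD measurableT ih iha).
      apply: eq_integral => y _; congr EFin; rewrite /hinge.
      by have [y0|y0] := leP 0 y; [rewrite ger0_norm//|rewrite ltr0_norm//];
         case: (leP 0 (y - 0)) => ?; lra.
    by rewrite (RintegralD measurableT ih iha) (RintegralD measurableT ih ia) mean_affine// mp.
  have i2 : P.-integrable [set: R] (EFin \o (fun x => V x 0 + (0 + -1 * x))).
    exact: (integrableD measurableT iV0 i1).
  by apply: integrable_lty => //; exact: (integrableD measurableT iV0 i2).
have QQ' : call Q' = call Q.
  by apply/funext => t; apply: EFin_inj; rewrite callE.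
rewrite -(eq_probability_call fQ' fQ QQ' mA).
exact: mixtureE.
Qed.

Lemma affine_integral (P : {measure set R -> \bar R}) (x c d : R) :
  P [set: R] = 1%E ->
  P.-integrable [set: R] (EFin \o idfun) -> (\int[P]_y y%:E = x%:E)%E ->
  P.-integrable [set: R] (EFin \o (fun y => d + c * y)) /\
  (\int[P]_y (d + c * y)%:E = (d + c * x)%:E)%E.
Proof.
move=> P1 iP Px.
have id_ : P.-integrable [set: R] (cst d%:E).
  by apply/integrableP; split => //; rewrite integral_cst// P1 mule1 ltry.
have ic : P.-integrable [set: R] (fun y => c%:E * (EFin \o idfun) y)%E.
  exact: integrableZl.
split; first exact: (integrableD measurableT id_ ic).
transitivity (\int[P]_y (cst d%:E y + c%:E * (EFin \o idfun) y))%E; first by [].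
by rewrite integralD// integralZl// Px integral_cst// P1 mule1.
Qed.

Lemma jensen_ge0 (P : {measure set R -> \bar R}) x (phi : R -> R) :
  P [set: R] = 1%E ->
  P.-integrable [set: R] (EFin \o idfun) -> (\int[P]_y y%:E = x%:E)%E ->
  cvx phi -> (forall y, 0 <= phi y) -> ((phi x)%:E <= \int[P]_y (phi y)%:E)%E.
Proof.
move=> P1 iP Px cphi phi0.
have [c hc] := cvx_subgradient x cphi.
have [il El] := affine_integral c (phi x - c * x) P1 iP Px.
have -> : (\int[P]_y (phi y)%:E =
    \int[P]_y ((phi y - (phi x - c * x + c * y)) + (phi x - c * x + c * y))%:E)%E.
  by apply: eq_integral => y _; rewrite subrK.
rewrite (integralD_ge0_integrable _ _ il).
- by rewrite El subrK leeDr// integral_ge0// => y _; rewrite lee_fin; have := hc y; lra.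
- by apply: measurable_funB; apply: cvx_measurable => //; exact: cvx_affine.
- by move=> y; have := hc y; lra.
Qed.

(** [strassen] gives Q as a mixture of measures k x of mean x, and Jensen's
    inequality compares phi x with the integral of phi under k x.  A tangent
    line is first subtracted from phi, which makes it nonnegative; the line has
    the same integral under P and Q. *)
Lemma cx_le_of_call P Q : finite_moment 1 P -> finite_moment 1 Q ->
  mean P = mean Q -> (forall t, call P t <= call Q t) -> cx_le P Q.
Proof.
move=> fP fQ mPQ PQ; split => // phi /cvxP cphi.
have [k [k1 k2 Qk]] := strassen fP fQ mPQ PQ.
have [c hc] := cvx_subgradient 0 cphi.
pose psi y := phi y - (phi 0 + c * y).
have psi0 y : 0 <= psi y by rewrite /psi; have := hc y; rewrite subr0; lra.
have cpsi : cvx psi.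
  have -> : psi = phi \+ (fun y => - phi 0 + (- c) * y) by apply/funext => y; rewrite /psi/=; lra.
  by apply: cvxD => //; exact: cvx_affine.
have mpsi := cvx_measurable cpsi.
have E S : finite_moment 1 S ->
    (\int[S]_y (phi y)%:E = \int[S]_y (psi y)%:E + (phi 0 + c * mean S)%:E)%E.
  move=> fS; rewrite -mean_affine//.
  have ia := integrable_affine c (phi 0) fS.
  have -> : (\int[S]_y (phi 0 + c * y))%:E = (\int[S]_y (phi 0 + c * y)%:E)%E.
    by rewrite /Rintegral fineK//; exact: integrable_fin_num.
  rewrite -integralD_ge0_integrable//.
  by apply: eq_integral => y _; rewrite /psi subrK.
rewrite !E// mPQ leeD2r//.
have mEpsi : measurable_fun [set: R] (EFin \o psi) by apply/measurable_EFinP.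
have -> : (\int[Q]_y (psi y)%:E = \int[P]_x \int[k x]_y (psi y)%:E)%E.
  rewrite (@eq_measure_integral _ _ _ _ (mixture P k)).
    by rewrite integral_mixture// => y; rewrite lee_fin.
  by move=> A mA _; exact: etrans (Qk A mA) (esym (mixtureE P k A)).
apply: ge0_le_integral => //.
- by move=> x _; rewrite lee_fin.
- by apply: measurable_fun_integral_kernel => //; exact: measurable_kernel.
- move=> x _; apply: jensen_ge0 => //; exact: prob_kernel.
Qed.

Lemma cx_le_mean P Q : cx_le P Q -> mean P = mean Q.
Proof.
move=> [fP fQ PQ]; apply/eqP; rewrite eq_le; apply/andP; split.
  rewrite -lee_fin !meanE//; apply: PQ; apply/cvxP => a b t _ _; lra.
suff : - mean P <= - mean Q by rewrite lerN2.
have E S : finite_moment 1 S -> (- mean S)%:E = (\int[S]_x (- x)%:E)%E.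
  move=> fS; have -> : - mean S = 0 + (-1) * mean S by lra.
  rewrite -mean_affine// /Rintegral fineK; last first.
    by apply: integrable_fin_num => //; exact: (integrable_affine (-1) 0 fS).
  by apply: eq_integral => x _; congr EFin; lra.
by rewrite -lee_fin !E//; apply: PQ; apply/cvxP => a b t _ _; lra.
Qed.

Lemma cx_le_call P Q : cx_le P Q -> forall t, call P t <= call Q t.
Proof.
move=> [fP fQ PQ] t; rewrite -lee_fin !callE//; apply: PQ.
by apply/cvxP; exact: hinge_cvx.
Qed.

End convex_order.

(** * Bounds of a family of measures with a common mean *)

Section families.
Context {R : realType}.
Implicit Types (S : set (probability R R)) (P Q eta : probability R R) (m t e : R).

Section fixed_mean.
Variables (S : set (probability R R)) (m : R).
Hypothesis S0 : S !=set0.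
Hypothesis fS : forall eta, S eta -> finite_moment 1 eta.
Hypothesis mS : forall eta, S eta -> mean eta = m.

Let cS eta : S eta -> call_function m (call eta).
Proof. by move=> Seta; rewrite -(mS Seta); exact/call_function_call/fS. Qed.

(** The call function of the infimum is the largest convex function below all
    call functions of the family.  Lower bounds of the family have mean m, and
    their call functions are among these minorants. *)
Lemma exists_cx_infimum : exists I, cx_infimum S I.
Proof.
have [eta0 S0'] := S0.
pose F := [set g : R -> R | cvx g /\ forall eta, S eta -> forall t, g t <= call eta t].
have FB g t : F g -> g t <= call eta0 t by move=> [_]; exact.
have Fm : F (hinge ^~ m).
  split; first exact: hinge_cvx_strike.
  by move=> eta Seta t; have [_] := cS Seta.
pose h t := sup [set g t | g in F].
have leh g t : F g -> g t <= h t.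
  by move=> Fg; apply: ub_le_sup; [exists (call eta0 t) => _ [f Ff <-]; exact: FB|exists g].
have hle eta t : S eta -> h t <= call eta t.
  move=> Seta; apply: ge_sup; first by exists (hinge t m), (hinge ^~ m).
  by move=> _ [g [_ Fg] <-]; exact: Fg.
have mh : call_function m h.
  apply: (call_function_squeeze (cS S0')) => [|t|t]; last exact: hle.
  - by apply: (cvx_sup (B := call eta0)) => [|g []//|g t]; [exists (hinge ^~ m)|exact: FB].
  - exact: leh Fm.
have [I [fI mI cI]] := call_function_realized mh.
exists I; split => // [eta Seta|l fl lS].
  apply: cx_le_of_call => //; [exact: fS|by rewrite mI mS|].
  by move=> t; rewrite cI; exact: hle.
apply: cx_le_of_call => //; first by rewrite mI -(mS S0'); exact/cx_le_mean/lS.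
move=> t; rewrite cI; apply: leh; split; first exact: cvx_call.
by move=> eta Seta; exact/cx_le_call/lS.
Qed.

(** The pointwise supremum of the call functions is convex; the majorant u
    keeps the mass of the family from escaping to infinity. *)
Lemma exists_cx_supremum (u : R -> R) :
  (forall eta, S eta -> forall t, call eta t <= u t) ->
  (forall e, 0 < e -> exists T, forall t, T <= t -> u t <= e) ->
  (forall e, 0 < e -> exists T, forall t, t <= T -> u t + t <= m + e) ->
  exists M, cx_supremum S M.
Proof.
move=> Su u1 u2; have [eta0 S0'] := S0.
pose h t := sup [set g t | g in [set call eta | eta in S]].
have leh eta t : S eta -> call eta t <= h t.
  move=> Seta; apply: ub_le_sup; last by exists (call eta) => //; exists eta.
  by exists (u t) => _ [_ [eta1 S1 <-] <-]; exact: Su.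
have hle t b : (forall eta, S eta -> call eta t <= b) -> h t <= b.
  move=> hb; apply: ge_sup; first by exists (call eta0 t), (call eta0) => //; exists eta0.
  by move=> _ [_ [eta1 S1 <-] <-]; exact: hb.
have hu t : h t <= u t by apply: hle => eta Seta; exact: Su.
have mh : call_function m h.
  split.
  - apply: (cvx_sup (B := u)); first by exists (call eta0), eta0.
      by move=> _ [eta1 S1 <-]; exact: call_cvx (cS S1).
    by move=> _ t [eta1 S1 <-]; exact: Su.
  - by move=> t; apply: le_trans (leh _ t S0'); have [_] := cS S0'.
  - by move=> e /u1[T hT]; exists T => t /hT; exact: le_trans.
  - by move=> e /u2[T hT]; exists T => t /hT; apply: le_trans; rewrite lerD2r.
have [M [fM mM cM]] := call_function_realized mh.
exists M; split => // [eta Seta|l fl lS].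
  apply: cx_le_of_call => //; [exact: fS|by rewrite mM mS|].
  by move=> t; rewrite cM; exact: leh.
apply: cx_le_of_call => //; first by rewrite mM -(mS S0'); exact/cx_le_mean/lS.
by move=> t; rewrite cM; apply: hle => eta Seta; exact/cx_le_call/lS.
Qed.

End fixed_mean.
End families.

(** * Squared increments of martingale couplings *)

Section squared_increments.
Context {R : realType}.
Implicit Types (P mu nu : probability R R) (pi : probability (R * R)%type R).

Lemma nonempty_martingale_coupling mu nu : cx_le mu nu ->
  martingale_coupling mu nu !=set0.
Proof.
move=> mn; have [fm fn _] := mn.
have [k [k1 k2 nuk]] := strassen fm fn (cx_le_mean mn) (cx_le_call mn).
exists (joint mu k); split; last first.
  by exists k => [A mA|]; [exact: jointE|exact: aeW].
move=> A mA; split; last exact: etrans (mixtureE mu k A) (esym (nuk A mA)).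
transitivity (joint mu k (fst @^-1` A)); first by [].
rewrite jointE; transitivity (\int[mu]_x (\1_A x)%:E)%E.
  2: by rewrite integral_indic// setIT.
apply: eq_integral => x _; rewrite xsectionE indicE.
have [xA|xA] := boolP (x \in A).
  rewrite (_ : _ @^-1` _ = setT) ?prob_kernel//.
  by apply/seteqP; split => // y _ /=; rewrite -in_setE.
rewrite (_ : _ @^-1` _ = set0) ?measure0//.
by apply/seteqP; split => // y /=; move: xA => /negP + /mem_set.
Qed.

Lemma mean_distribution_ge0 d (T : measurableType d) (P : probability T R)
    (X : {RV P >-> R}) :
  (forall w, 0 <= X w) -> (\int[P]_w (X w)%:E < +oo)%E ->
  finite_moment 1 (distribution P X) /\
  (mean (distribution P X))%:E = (\int[P]_w (X w)%:E)%E.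
Proof.
move=> X0 Xoo.
have fX : finite_moment 1 (distribution P X).
  rewrite /finite_moment/= ge0_integral_distribution//=.
  - by under eq_integral do rewrite powRr1// ger0_norm//.
  - by apply/measurable_EFinP; under eq_fun do rewrite powRr1//; exact: measurableT_comp.
split => //; rewrite meanE// integral_distribution//.
apply/integrableP; split; first by apply/measurable_EFinP; exact: measurable_funP.
by under eq_integral do rewrite /= ger0_norm//.
Qed.

Lemma measurable_square : measurable_fun [set: R] (fun x : R => x ^+ 2).
Proof. exact: measurable_funX. Qed.

Definition square_mfun := HB.pack_for {mfun R >-> R} (fun x : R => x ^+ 2)
  (@isMeasurableFun.Build _ _ R R (fun x : R => x ^+ 2) measurable_square).

Definition square_image P : probability R R := distribution P square_mfun.

Lemma integral_square_image P (f : R -> R) : measurable_fun [set: R] f ->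
  (forall x, 0 <= f x) ->
  (\int[square_image P]_z (f z)%:E = \int[P]_x (f (x ^+ 2))%:E)%E.
Proof.
by move=> mf f0; rewrite ge0_integral_distribution//; apply/measurable_EFinP.
Qed.

Lemma mean_square_image P : finite_moment 2 P ->
  finite_moment 1 (square_image P) /\
  (mean (square_image P))%:E = (\int[P]_x (x ^+ 2)%:E)%E.
Proof.
move=> P2; apply: mean_distribution_ge0 => [x|]; first exact: sqr_ge0.
apply: le_lt_trans P2; rewrite le_eqVlt; apply/orP; left; apply/eqP.
by apply: eq_integral => x _ /=; rewrite powR_mulrn// real_normK// num_real.
Qed.

Section coupling.
Variables (mu nu : probability R R) (pi : probability (R * R)%type R).
Hypothesis mu2 : finite_moment 2 mu.
Hypothesis nu2 : finite_moment 2 nu.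
Hypothesis pic : martingale_coupling mu nu pi.

Let integral_fst (f : R -> R) : measurable_fun [set: R] f -> (forall x, 0 <= f x) ->
  (\int[pi]_z (f z.1)%:E = \int[mu]_x (f x)%:E)%E.
Proof.
move=> mf f0; have [cpl _] := pic.
pose X := HB.pack_for {mfun (R * R)%type >-> R} (fst : R * R -> R)
  (@isMeasurableFun.Build _ _ (R * R)%type R fst measurable_fst).
rewrite (@eq_measure_integral _ _ _ _ (distribution pi X)).
  by rewrite ge0_integral_distribution//; apply/measurable_EFinP.
by move=> A mA _; exact: esym (cpl A mA).1.
Qed.

Let integral_snd (f : R -> R) : measurable_fun [set: R] f -> (forall x, 0 <= f x) ->
  (\int[pi]_z (f z.2)%:E = \int[nu]_x (f x)%:E)%E.
Proof.
move=> mf f0; have [cpl _] := pic.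
pose X := HB.pack_for {mfun (R * R)%type >-> R} (snd : R * R -> R)
  (@isMeasurableFun.Build _ _ (R * R)%type R snd measurable_snd).
rewrite (@eq_measure_integral _ _ _ _ (distribution pi X)).
  by rewrite ge0_integral_distribution//; apply/measurable_EFinP.
by move=> A mA _; exact: esym (cpl A mA).2.
Qed.

(** Given x, the martingale property makes \int (2 x y - x^2) k x (dy) equal to
    x^2, and y^2 = (y - x)^2 + (2 x y - x^2).  Integrating over x with possibly
    infinite values shows finiteness and the formula at once. *)
Lemma integral_sq : (\int[pi]_z (sq z)%:E =
  (mean (square_image nu) - mean (square_image mu))%:E)%E.
Proof.
have [_ [k pik kmart]] := pic.
have [_ Emu] := mean_square_image mu2.
have [_ Enu] := mean_square_image nu2.
have m1 : measurable_fun [set: R * R] (fun z : R * R => (z.1 ^+ 2)%:E).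
  by apply/measurable_EFinP; apply: measurable_funX; exact: measurable_fst.
have m2 : measurable_fun [set: R * R] (fun z : R * R => (z.2 ^+ 2)%:E).
  by apply/measurable_EFinP; apply: measurable_funX; exact: measurable_snd.
have msq : measurable_fun [set: R * R] (fun z : R * R => (sq z)%:E).
  by apply/measurable_EFinP; exact: measurable_sq.
have sq0 (z : R * R) : 0 <= sq z by exact: sqr_ge0.
have J f : measurable_fun [set: R * R] f -> (forall z, 0 <= f z)%E ->
    (\int[pi]_z f z = \int[mu]_x \int[k x]_y f (x, y))%E.
  move=> mf f0; rewrite -integral_joint//; apply: eq_measure_integral => A mA _.
  exact: etrans (pik A mA) (esym (jointE mu k A)).
suff E : (\int[pi]_z (sq z)%:E + (mean (square_image mu))%:E = (mean (square_image nu))%:E)%E.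
  by rewrite EFinB -E addeK.
have sqr0 (x : R) : 0 <= x ^+ 2 by exact: sqr_ge0.
rewrite Emu Enu -(integral_fst measurable_square sqr0) -(integral_snd measurable_square sqr0).
rewrite -ge0_integralD//; try by move=> z _; rewrite lee_fin; exact: sqr_ge0.
have m3 : measurable_fun [set: R * R] (fun z : R * R => (sq z)%:E + (z.1 ^+ 2)%:E)%E.
  exact: emeasurable_funD.
have sum0 (z : R * R) : (0 <= (sq z)%:E + (z.1 ^+ 2)%:E)%E by rewrite -EFinD lee_fin addr_ge0.
have s0 (z : R * R) : (0 <= (z.2 ^+ 2)%:E)%E by rewrite lee_fin.
rewrite (J _ m3 sum0) (J _ m2 s0).
have mI1 := measurable_fun_integral_finite_kernel _ k sum0 m3.
have mI2 := measurable_fun_integral_finite_kernel _ k s0 m2.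
apply: (ge0_ae_eq_integral measurableT mI1 mI2).
- by move=> x _; exact: integral_ge0.
- by move=> x _; exact: integral_ge0.
apply: filterS kmart => x kx _.
have ik : (k x).-integrable [set: R] (EFin \o idfun).
  apply/integrableP; split; first by apply/measurable_EFinP; exact: measurable_id.
  by rewrite /= integral_fin_num_abs// kx.
have msx : measurable_fun [set: R] (fun y : R => sq (x, y)).
  by rewrite /sq/=; apply: measurable_funX; exact: measurable_funB.
have [ia Ea] := affine_integral (2 * x) (- x ^+ 2) (prob_kernel x) ik kx.
have [ib Eb] := affine_integral 0 (x ^+ 2) (prob_kernel x) ik kx.
transitivity (\int[k x]_y (sq (x, y) + (x ^+ 2 + 0 * y))%:E)%E.
  by apply: eq_integral => y _; rewrite -EFinD/= mul0r addr0.
transitivity (\int[k x]_y (sq (x, y) + (- x ^+ 2 + 2 * x * y))%:E)%E; last first.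
  by apply: eq_integral => y _; congr EFin; rewrite /sq/=; lra.
rewrite (integralD_ge0_integrable msx (fun y => sq0 (x, y)) ia) Ea.
rewrite (integralD_ge0_integrable msx (fun y => sq0 (x, y)) ib) Eb.
by congr (_ + _%:E)%E; lra.
Qed.

Lemma mean_sq_image : finite_moment 1 (sq_image pi) /\
  mean (sq_image pi) = mean (square_image nu) - mean (square_image mu).
Proof.
have [|f1 m1] := @mean_distribution_ge0 _ _ pi sq (fun z => sqr_ge0 _).
  by rewrite integral_sq ltry.
by split => //; apply: EFin_inj; rewrite m1 integral_sq.
Qed.

Let integral_sq_image (f : R -> R) : measurable_fun [set: R] f ->
  (forall x, 0 <= f x) ->
  (\int[sq_image pi]_z (f z)%:E = \int[pi]_z (f (sq z))%:E)%E.
Proof.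
by move=> mf f0; rewrite ge0_integral_distribution//; apply/measurable_EFinP.
Qed.

(** From (y - x)^2 <= 2 x^2 + 2 y^2, by splitting t in two equal parts; the
    bound depends on mu and nu but not on the coupling. *)
Lemma call_sq_image t : call (sq_image pi) t <=
  2 * call (square_image mu) (t / 4) + 2 * call (square_image nu) (t / 4).
Proof.
have [fs _] := mean_sq_image.
have [fm _] := mean_square_image mu2.
have [fn _] := mean_square_image nu2.
have mh : measurable_fun [set: R] (fun x : R => hinge (t / 4) (x ^+ 2)).
  by apply: (measurableT_comp (measurable_hinge _)); exact: measurable_square.
have h0 (x : R) : 0 <= hinge (t / 4) (x ^+ 2) by exact: hinge_ge0.
rewrite -lee_fin EFinD !EFinM !callE//.
rewrite integral_sq_image; [|exact: measurable_hinge|exact: hinge_ge0].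
rewrite !integral_square_image; try exact: measurable_hinge; try exact: hinge_ge0.
rewrite -(integral_fst mh h0) -(integral_snd mh h0).
have mf1 : measurable_fun [set: R * R] (fun z : R * R => (hinge (t / 4) (z.1 ^+ 2))%:E).
  by apply/measurable_EFinP; apply: (measurableT_comp mh); exact: measurable_fst.
have mf2 : measurable_fun [set: R * R] (fun z : R * R => (hinge (t / 4) (z.2 ^+ 2))%:E).
  by apply/measurable_EFinP; apply: (measurableT_comp mh); exact: measurable_snd.
rewrite -!ge0_integralZl_EFin//; try by move=> z _; rewrite lee_fin hinge_ge0.
rewrite -ge0_integralD//; try by move=> z _; rewrite -EFinM lee_fin mulr_ge0// hinge_ge0.
- apply: ge0_le_integral => //.
  + by move=> z _; rewrite lee_fin hinge_ge0.
  + apply/measurable_EFinP; apply: (measurableT_comp (measurable_hinge _)); exact: measurable_sq.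
  + by apply: emeasurable_funD; exact: measurable_funeM.
  + move=> z _; rewrite -!EFinM -EFinD lee_fin; apply: hinge_le.
      by rewrite addr_ge0// mulr_ge0// hinge_ge0.
    have := hinge_ge (t / 4) (z.1 ^+ 2); have := hinge_ge (t / 4) (z.2 ^+ 2).
    have := sqr_ge0 (z.1 + z.2); rewrite /sq; lra.
- exact: measurable_funeM.
- exact: measurable_funeM.
Qed.

(** The squares put no mass on ]-oo, 0[, so at 0 the call function is already
    equal to the mean. *)
Lemma call_sq_image_nonpos t : t <= 0 ->
  call (sq_image pi) t + t <= mean (square_image nu) - mean (square_image mu).
Proof.
move=> t0; have [fs _] := mean_sq_image.
have := call_Lipschitz (call_function_call fs) t0.
suff : call (sq_image pi) 0 <= mean (square_image nu) - mean (square_image mu) by lra.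
rewrite -lee_fin callE// integral_sq_image; [|exact: measurable_hinge|exact: hinge_ge0].
rewrite -integral_sq le_eqVlt; apply/orP; left; apply/eqP.
apply: eq_integral => z _; congr EFin.
by rewrite /hinge subr0; apply/max_idPr; exact: sqr_ge0.
Qed.

End coupling.
End squared_increments.

Theorem proposition2p1 (R : realType) (mu nu : probability R R)
    (mu2 : finite_moment 2 mu) (nu2 : finite_moment 2 nu)
    (mu_nu : cx_le mu nu) :
  (exists m : probability R R,
     cx_infimum [set sq_image pi | pi in martingale_coupling mu nu] m) /\
  (exists M : probability R R,
     cx_supremum [set sq_image pi | pi in martingale_coupling mu nu] M).
Proof.
have [fm _] := mean_square_image mu2.
have [fn _] := mean_square_image nu2.
pose m := mean (square_image nu) - mean (square_image mu).
set S := [set _ | _ in _].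
have S0 : S !=set0.
  by have [pi0 h] := nonempty_martingale_coupling mu_nu; exists (sq_image pi0), pi0.
have fS eta : S eta -> finite_moment 1 eta.
  by move=> [pi h <-]; exact: (mean_sq_image mu2 nu2 h).1.
have mS eta : S eta -> mean eta = m.
  by move=> [pi h <-]; exact: (mean_sq_image mu2 nu2 h).2.
split; first exact: exists_cx_infimum S0 fS mS.
pose B t := 2 * call (square_image mu) (t / 4) + 2 * call (square_image nu) (t / 4).
apply: (exists_cx_supremum S0 fS mS (u := fun t => if t <= 0 then m - t else B t)).
- move=> _ [pi h <-] t; case: ifPn => t0; last exact: call_sq_image.
  by rewrite lerBrDr; exact: call_sq_image_nonpos.
- move=> e e0.
  have [T1 hT1] := call_small (call_function_call fm) (e := e / 4) ltac:(lra).
  have [T2 hT2] := call_small (call_function_call fn) (e := e / 4) ltac:(lra).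
  exists (Num.max 1 (Num.max (4 * T1) (4 * T2))) => t.
  rewrite !ge_max => /and3P[t1 tT1 tT2]; rewrite ifF; last by apply/negbTE; lra.
  by rewrite /B; have := hT1 (t / 4) ltac:(lra); have := hT2 (t / 4) ltac:(lra); lra.
- by move=> e e0; exists 0 => t t0; rewrite t0; lra.
Qed.
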